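(* The weakly monotone $C^*$-algebra $\mathcal{W}_{\mathbb{N}}$ over $\mathbb{N}$ is isomorphic to the universal $C^*$-algebra generated by a countable family of partial isometries $\{s_i: i=0,1,2,\ldots\}$ satisfying $s_i^*s_j=0$ for all $i\neq j$, $s_i^*s_i=\sum_{k=0}^i s_ks_k^*$ for all $i=0,1,2,\ldots$, and $s_0=s_0s_0^*$.
   Context: Here $\mathbb{N}=\{1,2,\ldots\}$ and $\{e_i:i\in\mathbb{N}\}$ is the canonical orthonormal basis of $\ell^2(\mathbb{N})$. The weakly monotone Fock space $\mathcal{F}_{wm}(\ell^2(\mathbb{N}))$ is the closed subspace of the full Fock space with orthonormal basis the vacuum $\Omega$ and all $e_{i_1}\otimes\cdots\otimes e_{i_k}$, $k\geq 1$, $i_1\geq\cdots\geq i_k\geq 1$. For $i\in\mathbb{N}$ the creator $A_i^\dagger$ is given by $A_i^\dagger\Omega=e_i$ and $A_i^\dagger\, e_{i_1}\otimes\cdots\otimes e_{i_k}=e_i\otimes e_{i_1}\otimes\cdots\otimes e_{i_k}$ if $i\geq i_1$ and $0$ otherwise; $A_i$ is its adjoint. $\mathcal{W}_{\mathbb{N}}\subset\mathcal{B}(\mathcal{F}_{wm}(\ell^2(\mathbb{N})))$ is the $C^*$-algebra generated by $\{A_i,A_i^\dagger:i\in\mathbb{N}\}$. *)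

(* Defs.v *)
From HB Require Import structures.
From mathcomp Require Import all_boot all_order all_algebra.
From mathcomp Require Import all_classical all_reals all_analysis.
From mathcomp Require Import complex lra.

Set Implicit Arguments.
Unset Strict Implicit.
Unset Printing Implicit Defensive.

Import Order.TTheory GRing.Theory Num.Theory.
Import numFieldNormedType.Exports.
Import ComplexField.Normc.

Local Open Scope classical_set_scope.
Local Open Scope complex_scope.
Local Open Scope ring_scope.

(* No unit is required: the universal algebra of the theorem has none.
   MathComp rings are unital, hence the explicit product. *)
HB.mixin Record CompleteNormedModule_isCStarAlgebra (R : realType) A
    of CompleteNormedModule R[i] A := {
  cmul : A -> A -> A;
  cstar : A -> A;
  cmulA : associative cmul;
  cmulDl : left_distributive cmul +%R;
  cmulDr : right_distributive cmul +%R;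
  cscalerAl : forall (c : R[i]) (a b : A), c *: cmul a b = cmul (c *: a) b;
  cscalerAr : forall (c : R[i]) (a b : A), c *: cmul a b = cmul a (c *: b);
  cstarK : involutive cstar;
  cstarD : {morph cstar : a b / a + b};
  cstarZ : forall (c : R[i]) (a : A), cstar (c *: a) = c^* *: cstar a;
  cstarM : forall a b : A, cstar (cmul a b) = cmul (cstar b) (cstar a);
  cnormM : forall a b : A, `|cmul a b| <= `|a| * `|b|;
  cnorm_star : forall a : A, `|cmul (cstar a) a| = `|a| ^+ 2
}.

#[short(type=cstarAlgType)]
HB.structure Definition CStarAlgebra (R : realType) :=
  {A of CompleteNormedModule_isCStarAlgebra R A & CompleteNormedModule R[i] A}.

Section cstar_algebras.
Variable R : realType.
Implicit Types A B : cstarAlgType R.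

Definition star_hom A B (f : A -> B) : Prop :=
  [/\ linear f,
      forall a b : A, f (cmul a b) = cmul (f a) (f b) &
      forall a : A, f (cstar a) = cstar (f a)].

Definition cstar_subalg A (S : set A) : Prop :=
  [/\ S 0 /\ (forall (c : R[i]) (a b : A), S a -> S b -> S (c *: a + b)),
      forall a b : A, S a -> S b -> S (cmul a b),
      forall a : A, S a -> S (cstar a) &
      closed S].

Definition cstar_generated A (X : set A) : set A :=
  [set a | forall S, cstar_subalg S -> X `<=` S -> S a].

Definition partial_isometry A (v : A) : Prop := cmul (cmul v (cstar v)) v = v.

Definition wm_relations A (s : nat -> A) : Prop :=
  [/\ forall i, partial_isometry (s i),
      forall i j, i != j -> cmul (cstar (s i)) (s j) = 0,
      forall i, cmul (cstar (s i)) (s i) =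
                \sum_(k < i.+1) cmul (s k) (cstar (s k)) &
      s 0%N = cmul (s 0%N) (cstar (s 0%N))].

Definition wm_universal A (s : nat -> A) : Prop :=
  [/\ wm_relations s,
      cstar_generated (range s) = setT &
      forall B (t : nat -> B), wm_relations t ->
        exists f : A -> B, star_hom f /\ (forall i, f (s i) = t i)].

End cstar_algebras.

Section l2_space.
Variables (R : realType) (I : choiceType).

Definition sqsum (x : I -> R[i]^o) : \bar R :=
  (\esum_(i in [set: I]) (normc (x i) ^+ 2)%:E)%E.

Definition sq_summable : {pred I -> R[i]^o} :=
  [pred x | `[< (sqsum x < +oo)%E >]].

Lemma sqsumZ_lty (c : R[i]) (x : I -> R[i]^o) :
  (sqsum x < +oo)%E -> (sqsum (c *: x) < +oo)%E.
Proof.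
move=> xoo; apply: (@le_lt_trans _ _ ((normc c ^+ 2)%:E * sqsum x)%E).
  rewrite ge_ereal_sup//= => _ [X [finX _]] <-.
  rewrite [leLHS](_ : _ = (normc c ^+ 2)%:E *
      \sum_(i \in X) (normc (x i) ^+ 2)%:E)%E; last first.
    rewrite ge0_mule_fsumr; last by move=> i; rewrite lee_fin sqr_ge0.
    by apply: eq_fsbigr => i _; rewrite -EFinM -exprMn -normcM.
  rewrite lee_wpmul2l ?lee_fin ?sqr_ge0//.
  by apply: ereal_sup_ubound; exists X.
rewrite lte_mul_pinfty ?lee_fin ?sqr_ge0//.
Qed.

Lemma sqsumD_lty (x y : I -> R[i]^o) :
  (sqsum x < +oo)%E -> (sqsum y < +oo)%E -> (sqsum (x + y)%R < +oo)%E.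
Proof.
move=> xoo yoo; set D := (sqsum x + sqsum x + (sqsum y + sqsum y))%E.
apply: (@le_lt_trans _ _ D); last by rewrite !lte_add_pinfty.
have sq0 (z : I -> R[i]^o) i : (0 <= (normc (z i) ^+ 2)%:E)%E.
  by rewrite lee_fin sqr_ge0.
rewrite /D /sqsum -esumD// -[X in (_ + X)%E]esumD// -esumD; last 2 first.
- by move=> i _; rewrite adde_ge0.
- by move=> i _; rewrite adde_ge0.
apply: le_esum => i _; rewrite -!EFinD lee_fin.
have n0 z : 0 <= normc (z : R[i]) by case: z => a b; exact: sqrtr_ge0.
have rpq : normc (x i + y i : R[i]) <= normc (x i : R[i]) + normc (y i : R[i]).
  exact: le_normcD.
rewrite -[(x + y) i]/(x i + y i).
set r := normc _ in rpq *; set p := normc _ in rpq *; set q := normc _ in rpq *.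
have : r ^+ 2 <= (p + q) ^+ 2 by rewrite lerXn2r ?nnegrE ?addr_ge0 ?n0.
have := sqr_ge0 (p - q); nra.
Qed.

Lemma sq_summable_submod : submod_closed sq_summable.
Proof.
split=> [|c x y].
  rewrite inE; rewrite /sqsum esum1 ?ltry// => i _.
  by rewrite [normc _]normc0 expr0n.
rewrite !inE => xoo yoo.
by apply: sqsumD_lty => //; exact: sqsumZ_lty.
Qed.

HB.instance Definition _ :=
  GRing.isSubmodClosed.Build R[i] (I -> R[i]^o) sq_summable sq_summable_submod.

Record l2 := L2 { l2val :> I -> R[i]^o; _ : l2val \in sq_summable }.

HB.instance Definition _ := [isSub for l2val].
HB.instance Definition _ := [Choice of l2 by <:].
HB.instance Definition _ := [SubChoice_isSubLmodule of l2 by <:].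

Definition l2norm (x : l2) : R := Num.sqrt (fine (sqsum x)).

(* Sums of absolutely summable families over the discrete index set I. *)
Definition rsum (f : I -> R) : R :=
  fine (\esum_(i in [set: I]) (EFin \o f)^\+ i)%E -
  fine (\esum_(i in [set: I]) (EFin \o f)^\- i)%E.

Definition csum (f : I -> R[i]) : R[i] :=
  rsum (fun i => complex.Re (f i)) +i* rsum (fun i => complex.Im (f i)).

Definition l2inner (x y : l2) : R[i] := csum (fun i => (x i : R[i])^* * y i).

Definition bounded_op (T : l2 -> l2) : Prop :=
  linear T /\ exists M : R, forall x, l2norm (T x) <= M * l2norm x.

Definition adjoint_op (T S : l2 -> l2) : Prop :=
  forall x y, l2inner (T x) y = l2inner x (S y).

(* C*-subalgebras of B(l2); the last condition is norm-closedness. *)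
Definition op_cstar_subalg (S : set (l2 -> l2)) : Prop :=
  [/\ S `<=` bounded_op,
      S (fun=> 0) /\ (forall (c : R[i]) (T T' : l2 -> l2),
        S T -> S T' -> S (fun x => c *: T x + T' x)),
      forall T T', S T -> S T' -> S (T \o T'),
      forall T T', S T -> bounded_op T' -> adjoint_op T T' -> S T' &
      forall T, bounded_op T ->
        (forall e : R, 0 < e -> exists2 T', S T' &
          forall x, l2norm (T x - T' x) <= e * l2norm x) -> S T].

Definition op_cstar_generated (X : set (l2 -> l2)) : set (l2 -> l2) :=
  [set T | forall S, op_cstar_subalg S -> X `<=` S -> S T].

Fact delta_subproof (i : I) :
  (fun j => (j == i)%:R) \in sq_summable.
Proof.
rewrite inE; rewrite /sqsum (esumID [set i])//; last first.
  by move=> j _; rewrite lee_fin sqr_ge0.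
rewrite setTI esum_set1 ?lee_fin ?sqr_ge0// [X in (_ + X)%E]esum1 ?adde0 ?ltry//.
move=> j [_ /= /eqP/negbTE ji]; rewrite ji [normc _]normc0 expr0n//.
Qed.

Definition l2delta (i : I) : l2 := L2 (delta_subproof i).

End l2_space.

(* W is meant to be a C*-subalgebra of B(l2), whose involution is the adjoint. *)
Definition isomorphic_to_ops (R : realType) (I : choiceType)
    (A : cstarAlgType R) (W : set (l2 R I -> l2 R I)) : Prop :=
  exists phi : A -> l2 R I -> l2 R I,
    [/\ forall (c : R[i]) (a b : A) x,
          phi (c *: a + b) x = c *: phi a x + phi b x,
        forall a b : A, phi (cmul a b) = phi a \o phi b,
        forall a : A, adjoint_op (phi a) (phi (cstar a)),
        injective phi &
        range phi = W].

Definition is_wm_word (w : seq nat) : bool := all (leq 1) w && sorted geq w.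

(* Indexes the orthonormal basis: the word [:: i1; ...; ik] stands for
   e_i1 (x) ... (x) e_ik and the empty word for the vacuum. *)
Notation wm_word := {w : seq nat | is_wm_word w}.

Section weakly_monotone.
Variable R : realType.

Definition wm_fock := l2 R wm_word.

Fact wm_behead_subproof (w : wm_word) : is_wm_word (behead (val w)).
Proof.
case: w => -[//|i w] /= /andP[/= /andP[_ w1] /path_sorted ws].
by rewrite /is_wm_word w1.
Qed.

Definition wm_behead (w : wm_word) : wm_word :=
  exist is_wm_word _ (wm_behead_subproof w).

(* In coordinates, (A_i^dagger x)(i :: w) = x w, and 0 on all other words;
   see creator_delta and creator_delta0 below. *)
Definition creator_fun (i : nat) (x : wm_word -> R[i]^o) : wm_word -> R[i]^o :=
  fun w => if ohead (val w) == Some i then x (wm_behead w) else 0.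

Lemma sqsum_creator i x : (sqsum (creator_fun i x) <= sqsum x)%E.
Proof.
pose P := [set w : wm_word | ohead (val w) == Some i].
rewrite /sqsum (esumID P); last by move=> w _; rewrite lee_fin sqr_ge0.
rewrite [X in (_ + X)%E]esum1 ?adde0; last first.
  move=> w [_ /negP/negbTE]; rewrite /creator_fun => ->.
  by rewrite [normc _]normc0 expr0n.
rewrite setTI (eq_esum (b := fun w => (normc (x (wm_behead w)) ^+ 2)%:E)).
  rewrite -(esum_image P wm_behead (fun w => (normc (x w) ^+ 2)%:E)).
    rewrite [leRHS](esumID (wm_behead @` P)); last first.
      by move=> w _; rewrite lee_fin sqr_ge0.
    by rewrite setTI leeDl// esum_ge0// => w _; rewrite lee_fin sqr_ge0.
  move=> [[|a u] pu] [[|b v] pv]; rewrite !inE /P //=.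
  move=> /eqP ai /eqP bi /(congr1 val) /= uv.
  by apply: val_inj; rewrite /= uv; case: ai bi => -> [->].
by move=> w; rewrite /P /creator_fun /= => ->.
Qed.

Fact creator_subproof i (x : wm_fock) :
  creator_fun i x \in @sq_summable R wm_word.
Proof.
rewrite inE; apply: le_lt_trans (sqsum_creator i x) _.
by case: x => x /=; rewrite inE.
Qed.

Definition creator (i : nat) (x : wm_fock) : wm_fock :=
  L2 (creator_subproof i x).

(* The two cases of the definition of A_i^dagger on the basis vectors
   (u = [::] being the vacuum). *)
Lemma creator_delta i (u v : wm_word) :
  val v = i :: val u -> creator i (l2delta R u) = l2delta R v.
Proof.
move=> vE; apply: val_inj; apply/funext => w /=; rewrite /creator_fun.
rewrite -![in LHS]val_eqE -[in RHS]val_eqE /= vE.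
by case: (val w) => [//|j w'] /=; rewrite eqseq_cons -[_ == Some i]/(j == i);
  case: (j == i).
Qed.

Lemma creator_delta0 i (u : wm_word) :
  ~~ is_wm_word (i :: val u) -> creator i (l2delta R u) = 0.
Proof.
move=> iu; apply: val_inj; apply/funext => w /=; rewrite /creator_fun.
case: ifPn => // wi; rewrite -val_eqE /=; case: eqP => // wu.
case: w wi wu => [[//|j w'] pw] /= /eqP[ji] wu.
have uE : val u = w' := esym wu.
by rewrite uE -ji pw in iu.
Qed.

Lemma creator_bounded i : bounded_op (creator i).
Proof.
split=> [c x y|].
  apply: val_inj; apply/funext => w.
  rewrite -[RHS]/(c * creator_fun i x w + creator_fun i y w) /= /creator_fun.
  by case: ifP => // _; rewrite mulr0 addr0.
exists 1 => x; rewrite mul1r ler_wsqrtr// fine_le ?sqsum_creator//.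
  rewrite ge0_fin_numE; last by apply: esum_ge0 => *; rewrite lee_fin sqr_ge0.
  by have := valP (creator i x); rewrite inE.
rewrite ge0_fin_numE; last by apply: esum_ge0 => *; rewrite lee_fin sqr_ge0.
by have := valP x; rewrite inE.
Qed.

Definition wm_cstar : set (wm_fock -> wm_fock) :=
  op_cstar_generated [set T | exists2 i, (1 <= i)%N &
    T = creator i \/ bounded_op T /\ adjoint_op (creator i) T].

End weakly_monotone.

Arguments wm_cstar R : clear implicits.

(* Main.v *)
From HB Require Import structures.
From mathcomp Require Import finmap.
From mathcomp Require Import all_boot all_order all_algebra.
From mathcomp Require Import all_classical all_reals all_analysis.
From mathcomp Require Import complex lra ring.
Require Import Defs.

Set Implicit Arguments.
Unset Strict Implicit.
Unset Printing Implicit Defensive.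

Import Order.TTheory GRing.Theory Num.Theory.
Import numFieldNormedType.Exports.
Import ComplexField.Normc.

Local Open Scope classical_set_scope.
Local Open Scope complex_scope.
Local Open Scope ring_scope.

(** Inside the C*-algebra generated by the creators A_i^dagger put s_0 for the
    vacuum projection A_1 A_1^dagger - A_1^dagger A_1 and s_i = A_i^dagger for
    i >= 1. Acting on basis words, these operators satisfy the relations
    ([fgen_relations]) and generate ([fgen_generated]), so everything rests on
    universality: for every family t with the relations in a C*-algebra B, the
    assignment s_i |-> t_i must extend to a *-homomorphism. By density this is
    the estimate ||F(t)|| <= ||F(s)|| for all *-polynomials F
    ([nm_domination]), and no representation theory of B is used for it.

    Write p_k = t_k t_k^*. The relations turn every *-polynomial in the letters
    0..n into a combination of monomials t_U p_k t_V^*, where U k and V k are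
    weakly decreasing words ([rep_mul]). The identity
    p_k = sum_(j <= k) t_k p_j t_k^* lengthens U, so that at degree d one can
    reach a canonical family of monomials: k = 0, or U has length exactly d
    ([rep_spanned_canonical]). Two facts about this family matter.
    - On the Fock space the coefficients can be read off: the coefficient of
      s_U p_k s_V^* is the matrix entry at the basis vectors e_(U k), e_(V k)
      ([entry_fgen]), hence it is at most ||F(s)|| in modulus.
    - A decreasing word is determined by the multiplicities of its letters, so
      the family has only polynomially many members in d ([size_canonical]).
    As each t_U p_k t_V^* has norm at most 1, it follows that
    ||F(t)|| <= P(d) ||F(s)|| with P a polynomial depending on n only
    ([rep_poly_bound]). Now replace F by F^* F, k times in a row. Both norms are
    raised to the power N = 2^k by the C*-identity, while the degree grows at
    most like 3^k, so the factor is still polynomial in N. Taking N-th roots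
    and letting k grow removes it ([le_of_power_bound]).

    The closure of the set of pairs (F(s), F(t)) is then the graph of the
    homomorphism wanted ([wm_graph], [fgen_hom]). Given any universal pair
    (U, s), the two homomorphisms provided by the two universal properties are
    inverse to each other on generators. They are inverse everywhere because
    *-homomorphisms are contractive ([star_hom_nm]), which makes the set where
    a composite is the identity a C*-subalgebra ([star_hom_id]).

    The rest is Hilbert space theory over l2(I): the inner product, completeness,
    adjoints, and the fact that a norm-closed *-algebra of adjointable operators
    is a C*-algebra ([opalg]). *)

(** * Elementary C*-algebra theory *)

Definition invS (R : realType) (n : nat) : R := n.+1%:R^-1.

Lemma invS_gt0 (R : realType) n : 0 < invS R n.
Proof. by rewrite invr_gt0. Qed.

Lemma ler_invS (R : realType) n m : (m <= n)%N -> invS R n <= invS R m.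
Proof. by move=> mn; rewrite lef_pV2 ?posrE// ler_nat ltnS. Qed.

Lemma invS_lt (R : realType) (e : R) : 0 < e -> exists n, invS R n < e.
Proof.
move=> e0; exists (Num.truncn e^-1).
by rewrite -[ltRHS]invrK ltf_pV2 ?posrE ?invr_gt0// truncnS_gt.
Qed.

Section cstar_theory.
Variables (R : realType).
Implicit Types A : cstarAlgType R.

(** The norm as a real number; the norm of a C*-algebra over R[i] takes its
    values in R[i], where the order is only partial. *)
Definition nm A (a : A) : R := complex.Re `|a|.

Lemma nmE A (a : A) : `|a| = (nm a)%:C.
Proof. by rewrite RRe_real// normr_real. Qed.

Lemma nm_ge0 A (a : A) : 0 <= nm a.
Proof. by rewrite -lecR -nmE normr_ge0. Qed.

Lemma nmD A (a b : A) : nm (a + b) <= nm a + nm b.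
Proof. by rewrite -lecR rmorphD/= -!nmE ler_normD. Qed.

Lemma nmN A (a : A) : nm (- a) = nm a.
Proof. by rewrite /nm normrN. Qed.

Lemma nmBC A (a b : A) : nm (a - b) = nm (b - a).
Proof. by rewrite -nmN opprB. Qed.

Lemma nmB A (a b : A) : nm (a - b) <= nm a + nm b.
Proof. by rewrite -(nmN b) nmD. Qed.

Lemma nm0 A : nm (0 : A) = 0.
Proof. by rewrite /nm normr0. Qed.

Lemma nm_eq0 A (a : A) : nm a = 0 -> a = 0.
Proof. by move=> a0; apply/eqP; rewrite -normr_eq0 nmE a0. Qed.

Lemma nmZ A (c : R[i]) (a : A) : nm (c *: a) = normc c * nm a.
Proof.
apply: complexI; rewrite /nm normrZ -/(nm _) nmE; case: c => x y.
by rewrite normc_def/= !mul0r subr0.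
Qed.

Lemma nmM A (a b : A) : nm (cmul a b) <= nm a * nm b.
Proof. by rewrite -lecR rmorphM/= -!nmE cnormM. Qed.

Lemma nm_starM A (a : A) : nm (cmul (cstar a) a) = nm a ^+ 2.
Proof. by apply: complexI; rewrite rmorphXn/= -!nmE cnorm_star. Qed.

(** By the C*-identity |b|^2 = |b^* b| <= |b^*| |b|, so |b| <= |b^*|; apply this
    to b and to b^*. *)
Lemma nm_star A (a : A) : nm (cstar a) = nm a.
Proof.
have le_star (b : A) : nm b <= nm (cstar b).
  have := nm_starM b; have := nmM (cstar b) b.
  have [->|b0 le_b eq_b] := eqVneq (nm b) 0; first by rewrite nm_ge0.
  have b_gt0 : 0 < nm b by rewrite lt_def b0 nm_ge0.
  by rewrite -(ler_pM2r b_gt0) -expr2 -eq_b.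
by apply/eqP; rewrite eq_le le_star -{2}(cstarK a) le_star.
Qed.

Lemma cmul0l A (a : A) : cmul 0 a = 0.
Proof. by have := cscalerAl 0 a a; rewrite !scale0r. Qed.

Lemma cmul0r A (a : A) : cmul a 0 = 0.
Proof. by have := cscalerAr 0 a a; rewrite !scale0r. Qed.

Lemma cmulNl A (a b : A) : cmul (- a) b = - cmul a b.
Proof. by rewrite -scaleN1r -cscalerAl scaleN1r. Qed.

Lemma cmulNr A (a b : A) : cmul a (- b) = - cmul a b.
Proof. by rewrite -scaleN1r -cscalerAr scaleN1r. Qed.

Lemma cmulBl A (a b c : A) : cmul (a - b) c = cmul a c - cmul b c.
Proof. by rewrite cmulDl cmulNl. Qed.

Lemma cmulBr A (a b c : A) : cmul a (b - c) = cmul a b - cmul a c.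
Proof. by rewrite cmulDr cmulNr. Qed.

Lemma cstar0 A : cstar (0 : A) = 0.
Proof. by have := cstarZ 0 (0 : A); rewrite scaler0 rmorph0 scale0r. Qed.

Lemma cstarN A (a : A) : cstar (- a) = - cstar a.
Proof. by rewrite -scaleN1r cstarZ rmorphN rmorph1 scaleN1r. Qed.

Lemma cstarB A (a b : A) : cstar (a - b) = cstar a - cstar b.
Proof. by rewrite cstarD cstarN. Qed.

Lemma cmul_suml A (I : Type) (r : seq I) P (F : I -> A) (a : A) :
  cmul (\sum_(i <- r | P i) F i) a = \sum_(i <- r | P i) cmul (F i) a.
Proof. exact: (big_morph (fun x => cmul x a) (fun x y => cmulDl x y a) (cmul0l a)). Qed.

Lemma cmul_sumr A (I : Type) (r : seq I) P (F : I -> A) (a : A) :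
  cmul a (\sum_(i <- r | P i) F i) = \sum_(i <- r | P i) cmul a (F i).
Proof. exact: (big_morph (cmul a) (cmulDr a) (cmul0r a)). Qed.

Lemma cstar_sum A (I : Type) (r : seq I) P (F : I -> A) :
  cstar (\sum_(i <- r | P i) F i) = \sum_(i <- r | P i) cstar (F i).
Proof. exact: (big_morph cstar (@cstarD _ A) (cstar0 A)). Qed.

Lemma nm_sum A (I : Type) (r : seq I) P (F : I -> A) :
  nm (\sum_(i <- r | P i) F i) <= \sum_(i <- r | P i) nm (F i).
Proof.
elim/big_ind2 : _ => [|x1 x2 y1 y2 l1 l2|//]; first by rewrite nm0.
by apply: le_trans (nmD _ _) _; rewrite lerD.
Qed.

Lemma nm_closedP A (S : set A) :
  closed S <-> forall a, (forall e : R, 0 < e -> exists2 a', S a' & nm (a - a') <= e)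
    -> S a.
Proof.
split=> [cS a ha|hS a].
  apply: cS => V /nbhs_ballP[e /= e0 eV].
  have := gtr0_real e0; move/complex_realP => -[r er].
  rewrite er ltcR in e0.
  have [a' Sa' aa'] := ha (r / 2) ltac:(by rewrite divr_gt0).
  exists a'; split=> //; apply: eV; rewrite -ball_normE /= er nmE ltcR; lra.
move=> ca; apply: hS => e e0.
have /ca[a' [Sa' aa']] : nbhs a (ball a e%:C) by apply: nbhsx_ballx; rewrite ltcR.
by exists a' => //; move: aa'; rewrite -ball_normE /= nmE ltcR => /ltW.
Qed.

Lemma nm_complete A (u : nat -> A) :
  (forall n m, nm (u n - u m) <= invS R n + invS R m) ->
  exists a, forall n, nm (u n - a) <= invS R n.
Proof.
move=> hu.
have [a ua] : exists a : A, u @ \oo --> a.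
  suff /cauchy_cvg/cvg_ex : cauchy (u @ \oo) by [].
  apply: (@cauchy_exP R[i] A) => e e0.
  have /complex_realP[r er] := gtr0_real e0; rewrite er ltcR in e0 *.
  have [n nr] := invS_lt (divr_gt0 e0 (ltr0n _ 2)).
  exists (u n); rewrite /fmap /=; near=> m; rewrite /= -ball_normE /= nmE ltcR.
  apply: le_lt_trans (hu n m) _.
  have : invS R m <= invS R n by apply: ler_invS; near: m; exact: nbhs_infty_ge.
  lra.
exists a => n; apply/ler_addgt0Pr => e e0.
have e2 : 0 < e / 2 by rewrite divr_gt0.
have [k ke] := invS_lt e2.
have /cvgr_dist_lt/(_ (e / 2)%:C) := ua; rewrite ltcR => /(_ e2)[N _ hN].
pose m := maxn N k.
have : nm (a - u m) < e / 2 by rewrite -ltcR -nmE; apply: hN; exact: leq_maxl.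
have : nm (u n - a) <= nm (u n - u m) + nm (a - u m).
  by rewrite (nmBC a) -{1}(subrK (u m) (u n)) -addrA nmD.
have := hu n m; have : invS R m <= invS R k by apply: ler_invS; exact: leq_maxr.
lra.
Unshelve. all: by end_near. Qed.

End cstar_theory.

(** * Contractivity of *-homomorphisms *)

Section automatic_continuity.
Variables (R : realType).
Implicit Types A B : cstarAlgType R.

Lemma nm_eq_lim A (C : R) (a b : A) :
  (forall n, nm (a - b) <= C * invS R n) -> a = b.
Proof.
move=> ab; apply/eqP; rewrite -subr_eq0; apply/eqP/nm_eq0/eqP.
rewrite eq_le nm_ge0 andbT; apply/ler_addgt0Pr => e e0; rewrite add0r.
have C0 : 0 < `|C| + 1 by rewrite ltr_wpDl.
have [n ne] := invS_lt (divr_gt0 e0 C0).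
apply: le_trans (ab n) _; rewrite ltr_pdivlMr// in ne.
have := invS_gt0 R n; have := ler_norm C; nra.
Qed.

Lemma expr_lt_eps (r e : R) : 0 <= r -> r < 1 -> 0 < e -> exists n, r ^+ n < e.
Proof.
move=> r0 r1 e0; have /cvgrPdist_lt/(_ e e0)[n _ /(_ n (leqnn n))] : r ^+ n @[n --> \oo] --> 0.
  by apply: cvg_expr; rewrite ger0_norm.
by rewrite /= sub0r normrN ger0_norm ?exprn_ge0//; exists n.
Qed.

(** This k is 1 - sqrt (1 - h^2), which makes sense without a unit. It is the
    fixed point of k |-> (h^2 + k^2) / 2, a contraction of the ball of radius
    |h| < 1 into itself; the iterates from 0 are polynomials in h, hence
    self-adjoint and commuting with h, and so is their limit. *)
Lemma selfadjoint_halfsquare A (h : A) : cstar h = h -> nm h < 1 ->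
  exists k, [/\ cstar k = k, cmul h k = cmul k h & k + k = cmul h h + cmul k k].
Proof.
move=> hs h1; set r := nm h; have r0 : 0 <= r := nm_ge0 h.
pose F (k : A) := (2^-1 : R[i]) *: (cmul h h + cmul k k).
pose u n := iter n F 0.
have FE k : F k + F k = cmul h h + cmul k k.
  rewrite /F -scalerDl -[RHS]scale1r; congr (_ *: _).
  by rewrite [RHS]splitr !mul1r.
have nmhalf (a : A) : nm ((2^-1 : R[i]) *: a) = 2^-1 * nm a.
  by rewrite nmZ normcV; congr (_^-1 * _); rewrite -[2]/(1 *+ 2) normcMn normc1.
have nmF k : nm k <= r -> nm (F k) <= r.
  move=> kr; rewrite nmhalf; have := nmD (cmul h h) (cmul k k).
  have := nmM h h; have := nmM k k; rewrite -/r; have := nm_ge0 k; nra.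
have Fcontr k l : nm k <= r -> nm l <= r -> nm (F k - F l) <= r * nm (k - l).
  move=> kr lr; rewrite -scalerBr nmhalf opprD addrACA subrr add0r.
  have -> : cmul k k - cmul l l = cmul k (k - l) + cmul (k - l) l.
    by rewrite cmulBr cmulBl addrA subrK.
  have := nmD (cmul k (k - l)) (cmul (k - l) l).
  have := nmM k (k - l); have := nmM (k - l) l; have := nm_ge0 (k - l); nra.
have ur n : nm (u n) <= r by elim: n => [|n ih]; [rewrite nm0|exact: nmF].
have u_cauchy n m : nm (u (n + m)%N - u n) <= r ^+ n.
  elim: n => [|n ih]; first by rewrite subr0 expr0 (le_trans (ur _)) ?ltW.
  by rewrite exprS; apply: le_trans (Fcontr _ _ (ur _) (ur _)) _; rewrite ler_wpM2l.
(* a subsequence that is Cauchy at the rate required by nm_complete *)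
have /choice[N hN] n : exists N, r ^+ N < invS R n.
  exact: expr_lt_eps r0 h1 (invS_gt0 R n).
have leN n m : (N n <= N m)%N -> nm (u (N n) - u (N m)) <= invS R n.
  move=> le_N; rewrite nmBC -(subnKC le_N); apply: le_trans (u_cauchy _ _) _.
  exact: ltW (hN n).
have [n m|k kP] := @nm_complete R A (u \o N).
  have [/leN le_n|/ltnW/leN le_m] := leqP (N n) (N m).
    by rewrite (le_trans le_n)// lerDl ltW// invS_gt0.
  by rewrite nmBC (le_trans le_m)// lerDr ltW// invS_gt0.
have us n : cstar (u n) = u n.
  elim: n => [|n ih]; first by rewrite cstar0.
  rewrite /= -/(u n) /F cstarZ cstarD !cstarM hs ih; congr (_ *: _).
  by rewrite rmorphV ?unitfE//= rmorph_nat.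
have uh n : cmul h (u n) = cmul (u n) h.
  elim: n => [|n ih]; first by rewrite cmul0r cmul0l.
  rewrite /= -/(u n) /F -cscalerAl -cscalerAr cmulDr cmulDl !cmulA ih.
  by rewrite -(cmulA (u n) h) ih cmulA.
exists k; split.
- apply: (@nm_eq_lim _ 2) => n; have := kP n => /=.
  have -> : cstar k - k = cstar (k - u (N n)) + (u (N n) - k).
    by rewrite cstarB us subrKA.
  move=> kn.
  have := nmD (cstar (k - u (N n))) (u (N n) - k).
  rewrite nm_star (nmBC k); lra.
- apply: (@nm_eq_lim _ (2 * r)) => n; have := kP n => /=; set v := u _ => kn.
  have -> : cmul h k - cmul k h = cmul (v - k) h - cmul h (v - k).
    by rewrite cmulBl cmulBr uh opprB [RHS]addrC subrKA.
  have := nmB (cmul (v - k) h) (cmul h (v - k)).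
  have := nmM (v - k) h; have := nmM h (v - k); have := nm_ge0 (v - k); rewrite -/r; nra.
- apply: (@nm_eq_lim _ (4 + r + nm k)) => n; have := kP n => /=; set v := u _ => kn.
  have -> : k + k - (cmul h h + cmul k k) =
     (k - F v) + (k - F v) + (cmul v (v - k) + cmul (v - k) k).
    rewrite cmulBr cmulBl subrKA [k - F v + _]addrACA -opprD FE !opprD addrA.
    by rewrite [X in _ = X + _]addrA subrKA.
  have vF : nm (F v - v) <= invS R n.
    have := u_cauchy (N n) 1; rewrite addn1 => /le_trans; apply; exact: ltW (hN n).
  have kF : nm (k - F v) <= 2 * invS R n.
    have := nmD (k - v) (v - F v); rewrite subrKA (nmBC k v) (nmBC v (F v)).
    lra.
  have := nmD (k - F v + (k - F v)) (cmul v (v - k) + cmul (v - k) k).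
  have := nmD (k - F v) (k - F v).
  have := nmD (cmul v (v - k)) (cmul (v - k) k).
  have := nmM v (v - k); have := nmM (v - k) k; have := ur (N n); rewrite -/v.
  have := nm_ge0 (v - k); have := nm_ge0 k; have := nm_ge0 v; nra.
Qed.

(** The hypotheses say X^2 + (1 - K)^2 = 1, so z = X + i (1 - K) is unitary in the
    unitization and 2 X = z + z^* has norm at most 2. Letting z and z^* act on
    an element b keeps the computation inside A: |z b| = |z^* b| = |b|, hence
    |X b| <= |b|, and b = X gives the claim. *)
Lemma contraction_of_halfsquare A (X K : A) :
  cstar X = X -> cstar K = K -> cmul X K = cmul K X ->
  K + K = cmul X X + cmul K K -> nm X <= 1.
Proof.
move=> Xs Ks XK KE.
have mid_cancel (p q r : A) : p + p - q + (r - p - (p - q)) = r.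
  by rewrite -[r - p - _]addrA -opprD [p + (p - q)]addrA addrCA subrr addr0.
have nmX b : nm (cmul X b) <= nm b.
  pose x := cmul X b; pose y := b - cmul K b.
  have xy : cmul (cstar x) y = cmul (cstar y) x.
    rewrite /x /y !(cstarM, cstarB) Xs Ks cmulBr cmulBl !cmulA.
    by rewrite -(cmulA _ X K) -(cmulA _ K X) XK.
  have xxyy : cmul (cstar x) x + cmul (cstar y) y = cmul (cstar b) b.
    rewrite /x /y !(cstarM, cstarB) Xs Ks !cmulBr !cmulBl !cmulA.
    rewrite -(cmulA _ X X) -[cmul X X](addrK (cmul K K)) -KE.
    rewrite !(cmulBr, cmulDr) !(cmulBl, cmulDl) !cmulA.
    exact: mid_cancel.
  have nmw (c : R[i]) : c^* = - c -> c ^+ 2 = -1 -> nm (x + c *: y) = nm b.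
    move=> cc c2; apply/eqP; rewrite -(@eqrXn2 _ 2)// ?nm_ge0// -!nm_starM.
    rewrite cstarD cstarZ cc cmulDl !cmulDr -!cscalerAl -!cscalerAr xy scalerA.
    by rewrite mulNr -expr2 c2 opprK scale1r scaleNr addrA addrK xxyy.
  have xx : (x + 'i%C *: y) + (x + (- 'i%C) *: y) = 2%:R *: x.
    by rewrite scaleNr addrACA subrr addr0 scaler_nat mulr2n.
  have := nmD (x + 'i%C *: y) (x + (- 'i%C) *: y); rewrite xx nmZ.
  have -> : normc (2%:R : R[i]) = 2 by rewrite -[2]/(1 *+ 2) normcMn normc1.
  have cI : ('i%C : R[i])^* = - 'i%C by apply/eqP; rewrite eq_complex /= oppr0 !eqxx.
  rewrite (nmw 'i%C cI (sqr_i R)) nmw ?sqrrN ?sqr_i//; last first.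
    by rewrite rmorphN/= cI.
  rewrite -/x; lra.
have [->|X0] := eqVneq (nm X) 0; first by rewrite ler01.
have := nmX X; rewrite -{1}Xs nm_starM expr2 -{3}[nm X]mul1r ler_pM2r//.
by rewrite lt_def X0 nm_ge0.
Qed.

(** The previous two lemmas give |f h| <= 1 for h self-adjoint with |h| < 1: the
    relation between h and k is algebraic, so f preserves it. Scaling and the
    C*-identity do the rest. *)
Lemma star_hom_nm A B (f : A -> B) : star_hom f -> forall a, nm (f a) <= nm a.
Proof.
move=> [fl fM fs].
have fZ c a : f (c *: a) = c *: f a.
  have f0 : f 0 = 0 by have := fl (-1) 0 0; rewrite !scaleN1r oppr0 addr0 addNr.
  by have := fl c a 0; rewrite !addr0 f0 addr0.
have fD a b : f (a + b) = f a + f b by have := fl 1 a b; rewrite !scale1r.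
have f_sa1 h : cstar h = h -> nm h < 1 -> nm (f h) <= 1.
  move=> hs h1; have [k [ks hk kE]] := selfadjoint_halfsquare hs h1.
  apply: (@contraction_of_halfsquare _ (f h) (f k)).
  - by rewrite -fs hs.
  - by rewrite -fs ks.
  - by rewrite -!fM hk.
  - by rewrite -!fM -!fD kE.
have f_sa h : cstar h = h -> nm (f h) <= nm h.
  move=> hs; apply/ler_addgt0Pr => e e0.
  have he : 0 < nm h + e by rewrite ltr_wpDl ?nm_ge0.
  have nc : normc ((nm h + e)^-1)%:C = (nm h + e)^-1.
    by rewrite /= expr0n addr0 sqrtr_sqr ger0_norm// invr_ge0 ltW.
  have := @f_sa1 ((nm h + e)^-1%:C *: h); rewrite fZ !nmZ nc.
  rewrite ![_^-1 * _]mulrC ltr_pdivrMr// ler_pdivrMr// !mul1r; apply; last by rewrite ltrDl.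
  by rewrite cstarZ hs; congr (_ *: _); exact: conjc_real.
move=> a; rewrite -(@ler_pXn2r _ 2)// ?nnegrE ?nm_ge0//.
by rewrite -!nm_starM -fs -fM f_sa// cstarM cstarK.
Qed.

End automatic_continuity.

(** * Sums of absolutely summable families *)

Section summation.
Variables (R : realType) (I : choiceType).
Implicit Types f g : I -> R.

Definition abs_summable f : Prop := summable [set: I] (EFin \o f).

Lemma abs_summableD f g :
  abs_summable f -> abs_summable g -> abs_summable (fun i => f i + g i).
Proof. exact: summableD. Qed.

Lemma abs_summable0 : abs_summable (fun=> 0).
Proof. by rewrite /abs_summable /summable esum1// => i _; rewrite /= normr0. Qed.

Lemma abs_summable_le f g :
  (forall i, `|f i| <= g i) -> abs_summable g -> abs_summable f.
Proof.
move=> fg; apply: le_lt_trans; apply: le_esum => i _ /=.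
by rewrite lee_fin (le_trans (fg i))// ler_norm.
Qed.

Lemma abs_summableZ (c : R) f : abs_summable f -> abs_summable (fun i => c * f i).
Proof.
rewrite /abs_summable /summable => fs.
apply: (@le_lt_trans _ _ (`|c|%:E * \esum_(i in [set: I]) `|(EFin \o f) i|)%E).
  rewrite ge_ereal_sup//= => _ [X [finX _]] <-.
  rewrite [leLHS](_ : _ = `|c|%:E * \sum_(i \in X) `|f i|%:E)%E; last first.
    rewrite ge0_mule_fsumr; last by move=> i; rewrite lee_fin normr_ge0.
    by apply: eq_fsbigr => i _; rewrite -EFinM -normrM.
  rewrite lee_wpmul2l ?lee_fin ?normr_ge0//.
  by apply: ereal_sup_ubound; exists X.
by rewrite lte_mul_pinfty ?lee_fin ?normr_ge0.
Qed.

Definition psum f : R := fine (\esum_(i in [set: I]) (f i)%:E)%E.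

Lemma psumE f : (forall i, 0 <= f i) -> abs_summable f ->
  (\esum_(i in [set: I]) (f i)%:E)%E = (psum f)%:E.
Proof.
move=> f0 fs; rewrite fineK// ge0_fin_numE; last first.
  by apply: esum_ge0 => i _; rewrite lee_fin.
apply: le_lt_trans fs; apply: le_esum => i _ /=.
by rewrite lee_fin ler_norm.
Qed.

Lemma psumD f g : (forall i, 0 <= f i) -> (forall i, 0 <= g i) ->
  abs_summable f -> abs_summable g ->
  psum (fun i => f i + g i) = psum f + psum g.
Proof.
move=> f0 g0 fs gs; apply: EFin_inj; rewrite EFinD -!psumE//.
- by rewrite -esumD// => i _; rewrite lee_fin.
- by move=> i; rewrite addr_ge0.
- exact: abs_summableD.
Qed.

Lemma psumZ (c : R) f : 0 <= c -> (forall i, 0 <= f i) -> abs_summable f ->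
  psum (fun i => c * f i) = c * psum f.
Proof.
have le_psumZ d h : 0 <= d -> (forall i, 0 <= h i) -> abs_summable h ->
    psum (fun i => d * h i) <= d * psum h.
  move=> d0 h0 hs; rewrite -lee_fin EFinM -!psumE//; last 2 first.
  - by move=> i; rewrite mulr_ge0.
  - exact: abs_summableZ.
  rewrite ge_ereal_sup//= => _ [X [finX _]] <-.
  rewrite [leLHS](_ : _ = d%:E * \sum_(i \in X) (h i)%:E)%E; last first.
    rewrite ge0_mule_fsumr; last by move=> i; rewrite lee_fin.
    by apply: eq_fsbigr => i _; rewrite -EFinM.
  rewrite lee_wpmul2l ?lee_fin//.
  by apply: ereal_sup_ubound; exists X.
move=> c0 f0 fs; have [->|cN0] := eqVneq c 0.
  rewrite mul0r /psum esum1// => i _; by rewrite mul0r.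
apply/eqP; rewrite eq_le le_psumZ//= mulrC -ler_pdivlMr ?lt_def ?cN0// mulrC.
rewrite -[leLHS](_ : psum (fun i => c^-1 * (c * f i)) = _); last first.
  by congr psum; apply/funext => i; rewrite mulKf.
by apply: le_psumZ; [rewrite invr_ge0|move=> i; rewrite mulr_ge0|exact: abs_summableZ].
Qed.

(** A sum defined through positive and negative parts can be computed from any
    other decomposition into nonnegative parts; this is what makes it linear. *)
Lemma rsum_diff f g : (forall i, 0 <= f i) -> (forall i, 0 <= g i) ->
  abs_summable f -> abs_summable g ->
  rsum (fun i => f i - g i) = psum f - psum g.
Proof.
move=> f0 g0 fs gs; apply: EFin_inj; rewrite [RHS]EFinB -!psumE//.
rewrite -(@esumB R I setT (EFin \o f) (EFin \o g) fs gs)//; last 2 first.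
- by move=> i _; rewrite lee_fin.
- by move=> i _; rewrite lee_fin.
have ds : summable setT ((EFin \o f) \- (EFin \o g))%E by exact: summableB.
have fin (h : I -> \bar R) : (forall i, 0 <= h i)%E -> summable setT h ->
    (\esum_(i in [set: I]) h i)%E \is a fin_num.
  by move=> h0; rewrite summableE (eq_esum (b := h))// => i _; rewrite gee0_abs.
rewrite /rsum EFinB !fineK//.
- by apply: fin => //; exact: summable_funeneg.
- by apply: fin => //; exact: summable_funepos.
Qed.

Definition posp f i : R := Num.max (f i) 0.
Definition negp f i : R := Num.max (- f i) 0.

Lemma posp_ge0 f i : 0 <= posp f i. Proof. by rewrite le_max lexx orbT. Qed.
Lemma negp_ge0 f i : 0 <= negp f i. Proof. by rewrite le_max lexx orbT. Qed.

Lemma pospB f i : f i = posp f i - negp f i.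
Proof. by rewrite /posp /negp; have [|] := leP (f i) 0; have [|] := leP (- f i) 0; lra. Qed.

Lemma posp_summable f : abs_summable f -> abs_summable (posp f).
Proof.
rewrite /abs_summable /summable; apply: le_lt_trans; apply: le_esum => i _ /=.
by rewrite lee_fin ger0_norm ?posp_ge0// ge_max ler_norm normr_ge0.
Qed.

Lemma negp_summable f : abs_summable f -> abs_summable (negp f).
Proof.
rewrite /abs_summable /summable; apply: le_lt_trans; apply: le_esum => i _ /=.
by rewrite lee_fin ger0_norm ?negp_ge0// ge_max normr_ge0 -normrN ler_norm.
Qed.

Lemma rsumE f : abs_summable f -> rsum f = psum (posp f) - psum (negp f).
Proof.
move=> fs; rewrite -rsum_diff.
- by congr rsum; apply/funext => i; exact: pospB.
- exact: posp_ge0.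
- exact: negp_ge0.
- exact: posp_summable.
- exact: negp_summable.
Qed.

Lemma rsum_ge0E f : (forall i, 0 <= f i) -> abs_summable f -> rsum f = psum f.
Proof.
move=> f0 fs; have := rsum_diff f0 (fun=> lexx 0) fs abs_summable0.
rewrite [psum (fun=> 0)]/psum [X in fine X]esum1// subr0 => <-.
by congr rsum; apply/funext => i; rewrite subr0.
Qed.

Lemma rsumD f g : abs_summable f -> abs_summable g ->
  rsum (fun i => f i + g i) = rsum f + rsum g.
Proof.
move=> fs gs; rewrite (rsumE fs) (rsumE gs).
have pf := posp_ge0 f; have nf := negp_ge0 f.
have pg := posp_ge0 g; have ng := negp_ge0 g.
have [pfs nfs] := (posp_summable fs, negp_summable fs).
have [pgs ngs] := (posp_summable gs, negp_summable gs).
rewrite addrACA -opprD -!psumD// -rsum_diff.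
- by congr rsum; apply/funext => i; rewrite (pospB f) (pospB g); lra.
- by move=> i; rewrite addr_ge0.
- by move=> i; rewrite addr_ge0.
- exact: abs_summableD.
- exact: abs_summableD.
Qed.

Lemma rsumZ (c : R) f : abs_summable f -> rsum (fun i => c * f i) = c * rsum f.
Proof.
move=> fs; have [pfs nfs] := (posp_summable fs, negp_summable fs).
have pf := posp_ge0 f; have nf := negp_ge0 f.
wlog c0 : c / 0 <= c => [hw|].
  have [/hw//|/ltW c0] := leP 0 c.
  have h0 : rsum (fun i => c * f i) + rsum (fun i => - c * f i) = 0.
    rewrite -rsumD; [|exact: abs_summableZ..].
    rewrite rsum_ge0E => [|i|]; last 2 first.
    - by rewrite mulNr subrr.
    - by apply: abs_summable_le abs_summable0 => i; rewrite mulNr subrr normr0.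
    by rewrite /psum esum1// => i _; rewrite mulNr subrr.
  rewrite (hw (- c)) ?oppr_ge0// in h0; lra.
rewrite (rsumE fs) mulrBr -!psumZ// -rsum_diff.
- by congr rsum; apply/funext => i; rewrite {1}(pospB f) mulrBr.
- by move=> i; rewrite mulr_ge0.
- by move=> i; rewrite mulr_ge0.
- exact: abs_summableZ.
- exact: abs_summableZ.
Qed.

End summation.

(** * The Hilbert space l2(I) *)

Section complex_sums.
Variables (R : realType) (I : choiceType).
Implicit Types f g : I -> R[i].

Lemma normc_ge0 (z : R[i]) : 0 <= normc z.
Proof. by case: z => a b; exact: sqrtr_ge0. Qed.

Lemma sqr_normcE (z : R[i]) : normc z ^+ 2 = complex.Re z ^+ 2 + complex.Im z ^+ 2.
Proof. by case: z => a b; rewrite sqr_sqrtr// addr_ge0// sqr_ge0. Qed.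

Lemma ler_Re_normc (z : R[i]) : `|complex.Re z| <= normc z.
Proof.
rewrite -(@ler_pXn2r _ 2)// ?nnegrE ?normr_ge0 ?normc_ge0//.
by rewrite sqr_normcE real_normK ?num_real// lerDl sqr_ge0.
Qed.

Lemma ler_Im_normc (z : R[i]) : `|complex.Im z| <= normc z.
Proof.
rewrite -(@ler_pXn2r _ 2)// ?nnegrE ?normr_ge0 ?normc_ge0//.
by rewrite sqr_normcE real_normK ?num_real// lerDr sqr_ge0.
Qed.

Lemma normc_conj (z : R[i]) : normc z^* = normc z.
Proof. by case: z => a b /=; rewrite sqrrN. Qed.

Lemma normc_real (r : R) : normc r%:C = `|r|.
Proof. by rewrite /= expr0n addr0 sqrtr_sqr. Qed.

Definition csummable f : Prop := abs_summable (fun i => normc (f i)).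

Lemma csummable_Re f : csummable f -> abs_summable (fun i => complex.Re (f i)).
Proof. by apply: abs_summable_le => i; exact: ler_Re_normc. Qed.

Lemma csummable_Im f : csummable f -> abs_summable (fun i => complex.Im (f i)).
Proof. by apply: abs_summable_le => i; exact: ler_Im_normc. Qed.

Lemma csumD f g : csummable f -> csummable g ->
  csum (fun i => f i + g i) = csum f + csum g.
Proof.
move=> fs gs; rewrite /csum; apply/eqP; rewrite eq_complex /=.
rewrite -!rsumD; [|exact: csummable_Im..|exact: csummable_Re|exact: csummable_Re].
by apply/andP; split; apply/eqP; congr rsum; apply/funext => i; rewrite raddfD.
Qed.

Lemma csumZ (c : R[i]) f : csummable f -> csum (fun i => c * f i) = c * csum f.
Proof.
move=> fs; have [fr fi] := (csummable_Re fs, csummable_Im fs).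
have rsumB (g h : I -> R) : abs_summable g -> abs_summable h ->
    rsum (fun i => g i - h i) = rsum g - rsum h.
  move=> gs hs; have := rsumD gs (abs_summableZ (-1) hs).
  rewrite (rsumZ _ hs) mulN1r => <-; congr rsum; apply/funext => i.
  by rewrite mulN1r.
case: c => a b; rewrite /csum; apply/eqP; rewrite eq_complex /=.
rewrite -!rsumZ// -rsumD; [|exact: abs_summableZ..].
rewrite -rsumB; [|exact: abs_summableZ..].
by apply/andP; split; apply/eqP; congr rsum; apply/funext => i; case: (f i).
Qed.

Lemma csum_conj f : csummable f -> csum (fun i => (f i)^*) = (csum f)^*.
Proof.
move=> fs; rewrite /csum; apply/eqP; rewrite eq_complex /=; apply/andP; split.
  by apply/eqP; congr rsum; apply/funext => i; case: (f i).
rewrite -mulN1r -rsumZ; last exact: csummable_Im.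
by apply/eqP; congr rsum; apply/funext => i; case: (f i) => ? ? /=; rewrite mulN1r.
Qed.

End complex_sums.

Section l2_inner.
Variables (R : realType) (I : choiceType).
Local Notation H := (l2 R I).
Implicit Types x y z : H.

Lemma l2_sqsum x : (sqsum x < +oo)%E.
Proof. by case: x => x /=; rewrite inE. Qed.

Lemma l2ZE (c : R[i]) x i : (c *: x) i = c * x i.
Proof. by []. Qed.

Lemma l2DE x y i : (x + y) i = x i + y i.
Proof. by []. Qed.

Lemma l2P x y : (forall i, x i = y i) -> x = y.
Proof. by move=> xy; apply: val_inj; apply/funext. Qed.

Lemma sq_abs_summable x : abs_summable (fun i => normc (x i) ^+ 2).
Proof.
apply: le_lt_trans (l2_sqsum x); apply: le_esum => i _ /=.
by rewrite lee_fin ger0_norm ?sqr_ge0.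
Qed.

Lemma l2norm_ge0 x : 0 <= l2norm x.
Proof. exact: sqrtr_ge0. Qed.

Lemma sqr_l2norm x : l2norm x ^+ 2 = psum (fun i => normc (x i) ^+ 2).
Proof. by rewrite sqr_sqrtr// fine_ge0// esum_ge0// => i _; rewrite lee_fin sqr_ge0. Qed.

Lemma inner_summable x y : csummable (fun i => (x i : R[i])^* * y i).
Proof.
apply: abs_summable_le (abs_summableD (sq_abs_summable x) (sq_abs_summable y)).
move=> i; rewrite ger0_norm ?normc_ge0// normcM normc_conj.
have := normc_ge0 (x i : R[i]); have := normc_ge0 (y i : R[i]); nra.
Qed.

Lemma l2innerDr x y z : l2inner x (y + z) = l2inner x y + l2inner x z.
Proof.
rewrite /l2inner -csumD; [|exact: inner_summable..].
by congr csum; apply/funext => i; rewrite -mulrDr.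
Qed.

Lemma l2innerZr (c : R[i]) x y : l2inner x (c *: y) = c * l2inner x y.
Proof.
rewrite /l2inner -csumZ; last exact: inner_summable.
by congr csum; apply/funext => i; rewrite l2ZE mulrCA.
Qed.

Lemma l2inner_conj x y : l2inner x y = (l2inner y x)^*.
Proof.
rewrite /l2inner -csum_conj; last exact: inner_summable.
by congr csum; apply/funext => i; rewrite rmorphM/= conjCK mulrC.
Qed.

Lemma l2innerDl x y z : l2inner (x + y) z = l2inner x z + l2inner y z.
Proof. by rewrite l2inner_conj l2innerDr rmorphD/= -!l2inner_conj. Qed.

Lemma l2innerZl (c : R[i]) x y : l2inner (c *: x) y = c^* * l2inner x y.
Proof. by rewrite l2inner_conj l2innerZr rmorphM/= -l2inner_conj. Qed.

Lemma l2inner_self x : l2inner x x = (l2norm x ^+ 2)%:C.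
Proof.
rewrite sqr_l2norm /l2inner /csum; apply/eqP; rewrite eq_complex /=; apply/andP; split.
  rewrite -rsum_ge0E; [|by move=> i; exact: sqr_ge0|exact: sq_abs_summable].
  apply/eqP; congr rsum; apply/funext => i; rewrite sqr_normcE.
  by case: (x i) => a b /=; rewrite mulNr opprK !expr2.
rewrite (_ : (fun i => _) = fun=> 0) ?rsum_ge0E//; last 2 first.
- exact: abs_summable0.
- by apply/funext => i; case: (x i) => a b /=; ring.
by apply/eqP; rewrite /psum esum1.
Qed.

Lemma l2norm_eq0 x : l2norm x = 0 -> x = 0.
Proof.
move=> x0; apply: l2P => i; apply: eq0_normc; apply/eqP; rewrite -sqrf_eq0.
rewrite eq_le sqr_ge0 andbT -lee_fin.
have : (sqsum x = 0)%E.
  rewrite /sqsum psumE ?x0; [|by move=> j; exact: sqr_ge0|exact: sq_abs_summable].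
  by rewrite -sqr_l2norm x0 expr0n.
move=> sx0; rewrite -[leRHS]sx0; apply: esum_ge; exists [set i]; first by split.
by rewrite fsbig_set1.
Qed.

Lemma l2norm0 : l2norm (0 : H) = 0.
Proof.
apply/eqP; rewrite -sqrf_eq0 sqr_l2norm /psum esum1// => i _.
by rewrite [normc _]normc0 expr0n.
Qed.

Lemma l2normZ (c : R[i]) x : l2norm (c *: x) = normc c * l2norm x.
Proof.
apply/eqP; rewrite -(@eqrXn2 _ 2)// ?mulr_ge0 ?normc_ge0 ?l2norm_ge0//.
apply/eqP/complexI; rewrite -l2inner_self l2innerZl l2innerZr l2inner_self mulrA.
rewrite exprMn [RHS]rmorphM; congr (_ * _); rewrite sqr_normcE.
by case: c => a b /=; apply/eqP; rewrite eq_complex /=; apply/andP; split; apply/eqP; ring.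
Qed.

Lemma sqr_l2normD x y :
  l2norm (x + y) ^+ 2 = l2norm x ^+ 2 + 2 * complex.Re (l2inner x y) + l2norm y ^+ 2.
Proof.
apply: complexI; rewrite -l2inner_self l2innerDl !l2innerDr (l2inner_conj y x).
rewrite !l2inner_self; case: (l2inner x y) => a b.
by apply/eqP; rewrite eq_complex /=; apply/andP; split; apply/eqP; ring.
Qed.

Lemma cauchy_schwarz x y : normc (l2inner x y) <= l2norm x * l2norm y.
Proof.
have [y0|y0] := eqVneq (l2norm y) 0.
  by rewrite (l2norm_eq0 y0) -(scale0r 0) l2innerZr mul0r normc0 l2normZ normc0 !mul0r mulr0.
set u := l2inner x y.
(* Expand |N x - <y, x> y|^2 >= 0: the vector is N times the component of x
   orthogonal to y. *)
set N := l2norm y ^+ 2; have N0 : 0 < N by rewrite exprn_gt0// lt_def y0 l2norm_ge0.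
have := sqr_ge0 (l2norm (N%:C *: x + (- u^*) *: y)).
rewrite sqr_l2normD !l2normZ l2innerZl l2innerZr -/u normcN normc_conj normc_real.
have -> : complex.Re (N%:C^* * (- u^* * u)) = - (N * normc u ^+ 2).
  by rewrite sqr_normcE; case: (u) => a b /=; ring.
rewrite (ger0_norm (ltW N0)) !exprMn -/N => le0.
rewrite -(@ler_pXn2r _ 2)// ?nnegrE ?mulr_ge0 ?normc_ge0 ?l2norm_ge0//.
by rewrite exprMn -/N -(ler_pM2l N0); nra.
Qed.

Lemma l2normD x y : l2norm (x + y) <= l2norm x + l2norm y.
Proof.
rewrite -(@ler_pXn2r _ 2)// ?nnegrE ?addr_ge0 ?l2norm_ge0// sqr_l2normD.
have := le_trans (ler_norm _) (le_trans (ler_Re_normc _) (cauchy_schwarz x y)).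
rewrite sqrrD; lra.
Qed.

Lemma l2normN x : l2norm (- x) = l2norm x.
Proof. by rewrite -scaleN1r l2normZ normcN normc1 mul1r. Qed.

Lemma l2normBC x y : l2norm (x - y) = l2norm (y - x).
Proof. by rewrite -l2normN opprB. Qed.

Lemma sqsum_le (x : I -> R[i]^o) (M : R) :
  (forall X : {fset I}, \sum_(i <- X) normc (x i) ^+ 2 <= M) ->
  (sqsum x <= M%:E)%E.
Proof.
move=> hM; rewrite ge_ereal_sup//= => _ [X [finX _]] <-.
by rewrite fsumEFin// lee_fin fsbig_finite.
Qed.

(** Norm bounds are checked on finitely many coordinates at a time. *)
Lemma l2norm_le x (M : R) : 0 <= M ->
  (forall X : {fset I}, \sum_(i <- X) normc (x i) ^+ 2 <= M ^+ 2) ->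
  l2norm x <= M.
Proof.
move=> M0 hM; rewrite -(@ler_pXn2r _ 2)// ?nnegrE ?l2norm_ge0//.
rewrite sqr_l2norm -lee_fin -psumE; first exact: sqsum_le.
- by move=> i; exact: sqr_ge0.
- exact: sq_abs_summable.
Qed.

Lemma sum_le_l2norm x (X : {fset I}) :
  \sum_(i <- X) normc (x i) ^+ 2 <= l2norm x ^+ 2.
Proof.
rewrite sqr_l2norm -lee_fin -psumE; last 2 first.
- by move=> i; exact: sqr_ge0.
- exact: sq_abs_summable.
apply: esum_ge; exists [set` X]; first by split.
by rewrite fsumEFin// lee_fin fsbig_finite// set_fsetK.
Qed.

Lemma coord_le_l2norm x i : normc (x i) <= l2norm x.
Proof.
rewrite -(@ler_pXn2r _ 2)// ?nnegrE ?normc_ge0 ?l2norm_ge0//.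
by have := sum_le_l2norm x [fset i]%fset; rewrite big_seq_fset1.
Qed.

End l2_inner.

Section l2_complete.
Variables (R : realType) (I : choiceType).
Local Notation H := (l2 R I).
Implicit Types x y z : H.

Lemma real_complete (C : R) (v : nat -> R) : 0 <= C ->
  (forall n m, `|v n - v m| <= C * (invS R n + invS R m)) ->
  exists l : R, v @ \oo --> l.
Proof.
move=> C0 hv; suff /cauchy_cvg/cvg_ex : cauchy (v @ \oo) by [].
apply: (@cauchy_exP R R) => e e0.
have C1 : 0 < 2 * (C + 1) by rewrite mulr_gt0 ?ltr_wpDl.
have [n nr] := invS_lt (divr_gt0 e0 C1); rewrite ltr_pdivlMr// in nr.
exists (v n); rewrite /fmap /=; near=> m; rewrite /= -ball_normE /=.
apply: le_lt_trans (hv n m) _.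
have : invS R m <= invS R n by apply: ler_invS; near: m; exact: nbhs_infty_ge.
have := invS_gt0 R n; nra.
Unshelve. all: by end_near. Qed.

Lemma l2_eq_lim (C : R) x y :
  (forall n, l2norm (x - y) <= C * invS R n) -> x = y.
Proof.
move=> xy; apply/eqP; rewrite -subr_eq0; apply/eqP/l2norm_eq0/eqP.
rewrite eq_le l2norm_ge0 andbT; apply/ler_addgt0Pr => e e0; rewrite add0r.
have C0 : 0 < `|C| + 1 by rewrite ltr_wpDl.
have [n ne] := invS_lt (divr_gt0 e0 C0).
apply: le_trans (xy n) _; rewrite ltr_pdivlMr// in ne.
have := invS_gt0 R n; have := ler_norm C; nra.
Qed.

Lemma cvg_invS : invS R n @[n --> \oo] --> 0.
Proof. exact: cvg_harmonic. Qed.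

(** The limit is taken coordinatewise; passing to the limit m -> oo in finite
    partial sums of |u n - u m|^2 shows that it is a limit in norm, and that
    u n - lim is square summable, hence so is the limit. *)
Lemma l2_complete (C : R) (u : nat -> H) : 0 <= C ->
  (forall n m, l2norm (u n - u m) <= C * (invS R n + invS R m)) ->
  exists x, forall n, l2norm (u n - x) <= C * invS R n.
Proof.
move=> C0 hu.
have coord n m i : normc (u n i - u m i : R[i]) <= C * (invS R n + invS R m).
  exact: le_trans (coord_le_l2norm (u n - u m) i) (hu n m).
have cvgRe i : exists l : R, complex.Re (u n i) @[n --> \oo] --> l.
  apply: (real_complete C0) => n m; apply: le_trans (coord n m i).
  by rewrite -raddfB; exact: ler_Re_normc.
have cvgIm i : exists l : R, complex.Im (u n i) @[n --> \oo] --> l.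
  apply: (real_complete C0) => n m; apply: le_trans (coord n m i).
  by rewrite -raddfB; exact: ler_Im_normc.
have [a ua] := choice cvgRe; have [b ub] := choice cvgIm.
pose l i : R[i] := a i +i* b i.
have sum_le n (X : {fset I}) :
    \sum_(i <- X) normc (u n i - l i : R[i]) ^+ 2 <= (C * invS R n) ^+ 2.
  have lhs : (\sum_(i <- X) normc (u n i - u m i : R[i]) ^+ 2) @[m --> \oo] -->
      \sum_(i <- X) normc (u n i - l i : R[i]) ^+ 2.
    apply: cvg_big => [|i _]; first exact: add_continuous.
    rewrite sqr_normcE; under eq_cvg do rewrite sqr_normcE.
    have cvg_sq (f : nat -> R) (c : R) : f @ \oo --> c -> f m ^+ 2 @[m --> \oo] --> c ^+ 2.
      by move=> fc; rewrite expr2; apply: cvgM.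
    apply: cvgD; apply: cvg_sq.
      rewrite raddfB/=; under eq_cvg do rewrite raddfB.
      by apply: cvgB; [exact: cvg_cst|exact: ua].
    rewrite raddfB/=; under eq_cvg do rewrite raddfB.
    by apply: cvgB; [exact: cvg_cst|exact: ub].
  have rhs : (C * (invS R n + invS R m)) ^+ 2 @[m --> \oo] --> (C * (invS R n + 0)) ^+ 2.
    apply: cvgM; (apply: cvgM; [exact: cvg_cst|]);
     (apply: cvgD; [exact: cvg_cst|exact: cvg_invS]).
  rewrite -[in leRHS](addr0 (invS R n)); apply: ler_cvg_to lhs rhs _.
  near=> m; apply: le_trans (sum_le_l2norm (u n - u m) X) _.
  by rewrite ler_pXn2r ?nnegrE ?l2norm_ge0 ?mulr_ge0 ?addr_ge0// ltW ?invS_gt0.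
have d_l2 n : (fun i => u n i - l i) \in @sq_summable R I.
  by rewrite inE; apply: le_lt_trans (sqsum_le (sum_le n)) _; rewrite ltry.
exists (u 0 - L2 (d_l2 0)) => n.
have -> : u n - (u 0 - L2 (d_l2 0)) = L2 (d_l2 n).
  apply: l2P => i; rewrite -[LHS]/(u n i - (u 0%N i - (u 0%N i - l i))) /=.
  by rewrite subKr.
apply: l2norm_le; last exact: sum_le.
by rewrite mulr_ge0// ltW ?invS_gt0.
Unshelve. all: by end_near. Qed.

End l2_complete.

(** * Bounded operators and adjoints *)

Section operators.
Variables (R : realType) (I : choiceType).
Local Notation H := (l2 R I).
Implicit Types (x y z : H) (S T : H -> H).

Lemma bounded_nneg T : bounded_op T ->
  exists2 M : R, 0 <= M & forall x, l2norm (T x) <= M * l2norm x.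
Proof.
move=> [_ [M hM]]; exists `|M| => // x; apply: le_trans (hM x) _.
by rewrite ler_wpM2r ?l2norm_ge0// ler_norm.
Qed.

Lemma bounded_linD T : bounded_op T -> forall x y, T (x + y) = T x + T y.
Proof. by move=> [lT _] x y; have := lT 1 x y; rewrite !scale1r. Qed.

Lemma bounded_lin0 T : bounded_op T -> T 0 = 0.
Proof.
by move=> [lT _]; have := lT (-1) 0 0; rewrite !scaleN1r oppr0 addr0 addNr.
Qed.

Lemma bounded_linZ T : bounded_op T -> forall c x, T (c *: x) = c *: T x.
Proof. by move=> bT c x; have := bT.1 c x 0; rewrite !addr0 bounded_lin0// addr0. Qed.

Lemma op_limit (T : nat -> H -> H) : (forall n, bounded_op (T n)) ->
  (forall n m x, l2norm (T n x - T m x) <= (invS R n + invS R m) * l2norm x) ->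
  exists2 T' : H -> H, bounded_op T' &
    forall n x, l2norm (T n x - T' x) <= invS R n * l2norm x.
Proof.
move=> bT hT.
have /choice[T' hT'] x : exists y, forall n, l2norm (T n x - y) <= l2norm x * invS R n.
  apply: l2_complete; first exact: l2norm_ge0.
  by move=> n m; rewrite mulrC.
exists T'; last by move=> n x; rewrite mulrC.
split.
  move=> c x y.
  apply: (@l2_eq_lim _ _ (l2norm (c *: x + y) + normc c * l2norm x + l2norm y)) => n.
  have -> : T' (c *: x + y) - (c *: T' x + T' y) =
     - (T n (c *: x + y) - T' (c *: x + y)) + (c *: (T n x - T' x) + (T n y - T' y)).
    by rewrite (bT n).1 opprB scalerBr [c *: _ - _ + _]addrACA -opprD subrKA.
  have := l2normD (- (T n (c *: x + y) - T' (c *: x + y))) (c *: (T n x - T' x) + (T n y - T' y)).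
  have := l2normD (c *: (T n x - T' x)) (T n y - T' y).
  rewrite l2normN l2normZ; have := hT' (c *: x + y) n.
  have := ler_wpM2l (normc_ge0 c) (hT' x n); have := hT' y n; lra.
have [M M0 hM] := bounded_nneg (bT 0%N).
exists (M + invS R 0) => x.
have := l2normD (T 0%N x) (- (T 0%N x - T' x)); rewrite opprB addrC subrK -opprB l2normN.
have := hM x; have := hT' x 0%N; lra.
Qed.

Lemma adjoint_sym S T : adjoint_op S T -> adjoint_op T S.
Proof. by move=> ST x y; rewrite l2inner_conj -ST -l2inner_conj. Qed.

Lemma l2inner0r x : l2inner x 0 = 0.
Proof. by have := l2innerZr 0 x 0; rewrite scale0r mul0r. Qed.

Lemma l2innerBr x y z : l2inner x (y - z) = l2inner x y - l2inner x z.
Proof. by rewrite l2innerDr -scaleN1r l2innerZr mulN1r. Qed.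

Lemma l2innerBl x y z : l2inner (x - y) z = l2inner x z - l2inner y z.
Proof. by rewrite l2inner_conj l2innerBr rmorphB/= -!l2inner_conj. Qed.

Lemma l2inner_ext x y : (forall z, l2inner z x = l2inner z y) -> x = y.
Proof.
move=> xy; apply/eqP; rewrite -subr_eq0; apply/eqP/l2norm_eq0/eqP.
rewrite -sqrf_eq0; apply/eqP/complexI; rewrite -l2inner_self l2innerBr.
by rewrite xy subrr.
Qed.

Lemma adjoint_uniq S T T' : adjoint_op S T -> adjoint_op S T' -> T = T'.
Proof. by move=> h h'; apply/funext => y; apply: l2inner_ext => x; rewrite -h -h'. Qed.

Lemma adjoint_comp S S' T T' :
  adjoint_op S S' -> adjoint_op T T' -> adjoint_op (S \o T) (T' \o S').
Proof. by move=> hS hT x y; rewrite /= hS hT. Qed.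

Lemma adjoint_lin (c : R[i]) S S' T T' : adjoint_op S S' -> adjoint_op T T' ->
  adjoint_op (fun x => c *: S x + T x) (fun x => c^* *: S' x + T' x).
Proof.
by move=> hS hT x y; rewrite l2innerDl l2innerDr l2innerZl l2innerZr hS hT.
Qed.

(** |T y|^2 = <S (T y), y> <= M |T y| |y|. *)
Lemma adjoint_bound (M : R) S T : 0 <= M ->
  (forall x, l2norm (S x) <= M * l2norm x) -> adjoint_op S T ->
  forall x, l2norm (T x) <= M * l2norm x.
Proof.
move=> M0 hM ST y; have [->|Ty0] := eqVneq (l2norm (T y)) 0.
  by rewrite mulr_ge0 ?l2norm_ge0.
have Ty_gt0 : 0 < l2norm (T y) by rewrite lt_def Ty0 l2norm_ge0.
rewrite -(ler_pM2r Ty_gt0) -expr2.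
have := cauchy_schwarz (S (T y)) y; rewrite ST l2inner_self normc_real.
rewrite ger0_norm ?sqr_ge0// => /le_trans; apply.
by rewrite mulrAC ler_wpM2r ?l2norm_ge0.
Qed.

Lemma adjoint_bounded S T : bounded_op S -> adjoint_op S T -> bounded_op T.
Proof.
move=> bS ST; split; last first.
  by have [M M0 hM] := bounded_nneg bS; exists M; exact: adjoint_bound hM ST.
move=> c x y; apply: l2inner_ext => z.
by rewrite -ST !l2innerDr !l2innerZr !ST.
Qed.

Lemma adjoint_lim (S S' : nat -> H -> H) T T' :
  (forall n x, l2norm (S n x - T x) <= invS R n * l2norm x) ->
  (forall n x, l2norm (S' n x - T' x) <= invS R n * l2norm x) ->
  (forall n, adjoint_op (S n) (S' n)) -> adjoint_op T T'.
Proof.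
move=> hT hT' hS x y; apply/eqP; rewrite -subr_eq0; apply/eqP/eq0_normc/eqP.
rewrite eq_le normc_ge0 andbT; apply/ler_addgt0Pr => e e0; rewrite add0r.
have C0 : 0 < 2 * l2norm x * l2norm y + 1 by rewrite ltr_wpDl ?mulr_ge0 ?l2norm_ge0.
have [n] := invS_lt (divr_gt0 e0 C0); rewrite ltr_pdivlMr// => ne.
have -> : l2inner (T x) y - l2inner x (T' y) =
    l2inner x (S' n y - T' y) - l2inner (S n x - T x) y.
  by rewrite l2innerBr l2innerBl -(hS n x y) opprB [RHS]addrC subrKA.
apply: le_trans (le_normcD _ _) _; rewrite normcN.
have h1 := le_trans (cauchy_schwarz x (S' n y - T' y)) (ler_wpM2l (l2norm_ge0 x) (hT' n y)).
have h2 := le_trans (cauchy_schwarz (S n x - T x) y) (ler_wpM2r (l2norm_ge0 y) (hT n x)).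
have := invS_gt0 R n; nra.
Qed.

Definition adjointable : set (H -> H) :=
  [set T | bounded_op T /\ exists T', adjoint_op T T'].

Lemma bounded_opD (c : R[i]) S T : bounded_op S -> bounded_op T ->
  bounded_op (fun x => c *: S x + T x).
Proof.
move=> bS bT; split.
  move=> d x y; rewrite bS.1 bT.1 scalerDr scalerA mulrC -scalerA scalerDr.
  by rewrite addrACA.
have [M M0 hM] := bounded_nneg bS; have [N N0 hN] := bounded_nneg bT.
exists (normc c * M + N) => x; apply: le_trans (l2normD _ _) _.
by rewrite l2normZ mulrDl -mulrA lerD// ler_wpM2l ?normc_ge0.
Qed.

Lemma bounded_op_comp S T : bounded_op S -> bounded_op T -> bounded_op (S \o T).
Proof.
move=> bS bT; split; first by move=> c x y; rewrite /= bT.1 bS.1.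
have [M M0 hM] := bounded_nneg bS; have [N N0 hN] := bounded_nneg bT.
exists (M * N) => x; apply: le_trans (hM _) _.
by rewrite -mulrA ler_wpM2l.
Qed.

Lemma bounded_op0 : bounded_op (fun _ : H => 0 : H).
Proof.
split; first by move=> c x y; rewrite scaler0 addr0.
by exists 0 => x; rewrite l2norm0 mul0r.
Qed.

(** The point is norm-closedness: adjoints of approximating operators are again
    Cauchy since S |-> S^* does not increase norms, and their limit is an adjoint
    of the limit. *)
Lemma adjointable_subalg : op_cstar_subalg adjointable.
Proof.
split.
- by move=> T [].
- split.
    split; first exact: bounded_op0.
    exists (fun=> 0) => x y; rewrite [LHS]l2inner_conj !l2inner0r; exact: rmorph0.
  move=> c S T [bS [S' hS]] [bT [T' hT]]; split; first exact: bounded_opD.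
  by eexists; exact: adjoint_lin hS hT.
- move=> S T [bS [S' hS]] [bT [T' hT]]; split; first exact: bounded_op_comp.
  by eexists; exact: adjoint_comp hS hT.
- move=> S T [bS _] bT ST; split=> //.
  by exists S; exact: adjoint_sym.
- move=> T bT hT; split=> //.
  have /choice[S hS] n : exists S, adjointable S /\
      forall x, l2norm (T x - S x) <= invS R n * l2norm x.
    by have [S aS TS] := hT _ (invS_gt0 R n); exists S.
  have /choice[S' hS'] n : exists S', adjoint_op (S n) S' by have [[_ aS] _] := hS n.
  have bS n : bounded_op (S n) by have [[]] := hS n.
  have bS' n : bounded_op (S' n) by exact: adjoint_bounded (bS n) (hS' n).
  have SS n m x : l2norm (S n x - S m x) <= (invS R n + invS R m) * l2norm x.
    rewrite -(subrKA (T x)) mulrDl; apply: le_trans (l2normD _ _) _.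
    by apply: lerD; [rewrite l2normBC; exact: (hS n).2|exact: (hS m).2].
  have SS' n m x : l2norm (S' n x - S' m x) <= (invS R n + invS R m) * l2norm x.
    have nm0 : 0 <= invS R n + invS R m by rewrite addr_ge0// ltW ?invS_gt0.
    have adj := adjoint_lin (-1) (hS' m) (hS' n).
    have bd z : l2norm ((-1) *: S m z + S n z) <= (invS R n + invS R m) * l2norm z.
      by rewrite scaleN1r addrC; exact: SS.
    have := adjoint_bound nm0 bd adj x.
    by rewrite rmorphN rmorph1 scaleN1r addrC.
  have [T' bT' hT'] := op_limit bS' SS'.
  exists T'; apply: adjoint_lim hT' hS' => n x.
  by rewrite l2normBC (hS n).2.
Qed.

End operators.

(** * Concrete C*-algebras of operators *)

Section operator_norm.
Variables (R : realType) (I : choiceType).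
Local Notation H := (l2 R I).
Implicit Types (x y z : H) (S T : H -> H).

Definition op_bounds T : set R :=
  [set M | 0 <= M /\ forall x, l2norm (T x) <= M * l2norm x].

Definition opnorm T : R := inf (op_bounds T).

Lemma has_inf_op_bounds T : bounded_op T -> has_inf (op_bounds T).
Proof.
move=> /bounded_nneg[M M0 hM]; split; first by exists M.
by exists 0 => N [].
Qed.

Lemma opnorm_ge0 T : bounded_op T -> 0 <= opnorm T.
Proof. by move=> /has_inf_op_bounds[bT0 _]; apply: lb_le_inf => // M []. Qed.

Lemma opnorm_le T (M : R) : 0 <= M ->
  (forall x, l2norm (T x) <= M * l2norm x) -> opnorm T <= M.
Proof. by move=> M0 hM; apply: ge_inf => //; exists 0 => N []. Qed.

Lemma opnormP T x : bounded_op T -> l2norm (T x) <= opnorm T * l2norm x.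
Proof.
move=> bT; apply/ler_addgt0Pr => e e0.
have C0 : 0 < l2norm x + 1 by rewrite ltr_wpDl ?l2norm_ge0.
have [M [M0 hM]] := inf_adherent (divr_gt0 e0 C0) (has_inf_op_bounds bT).
rewrite -/(opnorm T) -ltrBlDl ltr_pdivlMr// => Me.
have := hM x; have := l2norm_ge0 x; nra.
Qed.

End operator_norm.

(** Bundling the closure properties with the set lets the type of its elements
    carry the C*-algebra structure. *)
Structure opset (R : realType) (I : choiceType) := OpSet {
  opset_set :> set (l2 R I -> l2 R I);
  opset_subalg : op_cstar_subalg opset_set;
  opset_adj : opset_set `<=` @adjointable R I }.

Section opset_algebra.
Variables (R : realType) (I : choiceType) (W : opset R I).
Local Notation H := (l2 R I).

Local Notation inW := (opset_set W).

Definition opset_pred : {pred H -> H} := [pred T | `[< inW T >]].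

Lemma opset_submod : submod_closed opset_pred.
Proof.
have [_ [W0 WD] _ _ _] := opset_subalg W.
split=> [|c S T]; rewrite !inE; first exact: W0.
exact: WD.
Qed.

HB.instance Definition _ :=
  GRing.isSubmodClosed.Build R[i] (H -> H) opset_pred opset_submod.

Record opalg := OpAlg { opval :> H -> H; _ : opval \in opset_pred }.

HB.instance Definition _ := [isSub for opval].
HB.instance Definition _ := [Choice of opalg by <:].
HB.instance Definition _ := [SubChoice_isSubLmodule of opalg by <:].

Implicit Types a b : opalg.

Lemma opalgP a : inW a. Proof. by case: a => a /=; rewrite inE. Qed.

Lemma opalg_bounded a : bounded_op a.
Proof. by have [Wb _ _ _ _] := opset_subalg W; exact/Wb/opalgP. Qed.

Lemma opalg_eq a b : (forall x, a x = b x) -> a = b.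
Proof. by move=> ab; apply: val_inj; apply/funext. Qed.

Lemma opalgDE a b x : (a + b : opalg) x = a x + b x.
Proof. by []. Qed.

Lemma opalgZE (c : R[i]) a x : (c *: a : opalg) x = c *: a x.
Proof. by []. Qed.

Lemma opalgBE a b x : (a - b : opalg) x = a x - b x.
Proof. by []. Qed.

Definition mkop (T : H -> H) (WT : inW T) : opalg := OpAlg (asboolT WT).

Definition opalg_norm a : R[i] := (opnorm a)%:C.

Lemma opalg_normD a b : opalg_norm (a + b) <= opalg_norm a + opalg_norm b.
Proof.
rewrite -rmorphD lecR; apply: opnorm_le => [|x].
  by apply: addr_ge0; apply: opnorm_ge0; exact: opalg_bounded.
apply: le_trans (l2normD (a x) (b x)) _.
by rewrite mulrDl; apply: lerD; apply: opnormP; exact: opalg_bounded.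
Qed.

Lemma opalg_normZ (c : R[i]) a : opalg_norm (c *: a) = `|c| * opalg_norm a.
Proof.
have le_normZ d b : opnorm (d *: b : opalg) <= normc d * opnorm b.
  apply: opnorm_le => [|x].
    by rewrite mulr_ge0 ?normc_ge0 ?opnorm_ge0//; exact: opalg_bounded.
  rewrite [l2norm _](l2normZ d (b x)) -mulrA ler_wpM2l ?normc_ge0//.
  by apply: opnormP; exact: opalg_bounded.
have -> : `|c| = (normc c)%:C by case: c.
rewrite /opalg_norm -rmorphM; congr _%:C; apply/eqP; rewrite eq_le le_normZ andTb.
have [->|c0] := eqVneq c 0.
  by rewrite normc0 mul0r; apply: opnorm_ge0; exact: opalg_bounded.
have nc0 : 0 < normc c.
  by rewrite lt_def normc_ge0 andbT; apply: contraNneq c0 => /eq0_normc ->.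
rewrite mulrC -ler_pdivlMr// mulrC -normcV.
by have := le_normZ c^-1 (c *: a); rewrite scalerA mulVf// scale1r.
Qed.

Lemma opalg_norm0_eq0 a : opalg_norm a = 0 -> a = 0.
Proof.
move=> /complexI a0; apply: opalg_eq => x; apply: l2norm_eq0.
apply/eqP; rewrite eq_le l2norm_ge0 andbT.
by apply: le_trans (opnormP x (opalg_bounded a)) _; rewrite a0 mul0r.
Qed.

HB.instance Definition _ := Lmodule_isNormed.Build R[i] opalg
  opalg_normD opalg_normZ opalg_norm0_eq0.

Lemma opalg_normE a : `|a| = (opnorm a)%:C.
Proof. by []. Qed.

(** A Cauchy filter is followed along centres a n of balls of radius 1/(n+1) that
    it contains. *)
Lemma opalg_complete (F : set_system opalg) : ProperFilter F -> cauchy F -> cvg F.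
Proof.
move=> PF /cauchyP cF.
have /choice[a ha] n : exists a, F (ball a (invS R n)%:C).
  by apply: cF; rewrite ltcR invS_gt0.
have aa n m x : l2norm (a n x - a m x) <= (invS R n + invS R m) * l2norm x.
  have [b [bn bm]] : exists b, ball (a n) (invS R n)%:C b /\ ball (a m) (invS R m)%:C b.
    exact: filter_ex (filterI (ha n) (ha m)).
  have : `|a n - a m| <= (invS R n)%:C + (invS R m)%:C.
    rewrite -(subrKA b); apply: le_trans (ler_normD _ _) _; apply: lerD.
      by apply: ltW; move: bn; rewrite -ball_normE.
    by rewrite distrC; apply: ltW; move: bm; rewrite -ball_normE.
  rewrite -rmorphD opalg_normE lecR => le_nm.
  apply: le_trans (opnormP x (opalg_bounded (a n - a m))) _.
  by rewrite ler_wpM2r ?l2norm_ge0.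
have [T bT hT] := op_limit (fun n => opalg_bounded (a n)) aa.
have WT : inW T.
  have [_ _ _ _ Wc] := opset_subalg W; apply: Wc => // e e0.
  have [n ne] := invS_lt e0; exists (a n); first exact: opalgP.
  move=> x; rewrite l2normBC; apply: le_trans (hT n x) _.
  by rewrite ler_wpM2r ?l2norm_ge0// ltW.
apply/cvg_ex; exists (mkop WT); apply/cvg_ballP => e e0.
have /complex_realP[r er] := gtr0_real e0; rewrite er ltcR in e0 *.
have [n nr] := invS_lt (divr_gt0 e0 (ltr0n _ 2)).
apply: filterS (ha n) => b; rewrite -!ball_normE /= => bn.
have an : `|mkop WT - a n| <= (invS R n)%:C.
  rewrite opalg_normE lecR; apply: opnorm_le => [|x]; first exact/ltW/invS_gt0.
  by rewrite [X in l2norm X](_ : _ = T x - a n x)// l2normBC.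
rewrite -(subrKA (a n)); apply: le_lt_trans (ler_normD _ _) _.
apply: (@lt_le_trans _ _ ((invS R n)%:C + (invS R n)%:C)).
  exact: ler_ltD.
by rewrite -rmorphD lecR; lra.
Qed.

HB.instance Definition _ := Uniform_isComplete.Build opalg opalg_complete.

Lemma opset_comp a b : inW (a \o b).
Proof. by have [_ _ Wm _ _] := opset_subalg W; apply: Wm; exact: opalgP. Qed.

(** The adjoint of an element of W stays in W, being bounded. *)
Lemma opset_star a : exists T, inW T /\ adjoint_op a T.
Proof.
have [_ _ _ Ws _] := opset_subalg W.
have [ba [T aT]] := opset_adj (opalgP a).
by exists T; split=> //; apply: (Ws a) => //; [exact: opalgP|exact: adjoint_bounded aT].
Qed.

Definition opalg_mul a b : opalg := mkop (opset_comp a b).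
Definition opalg_star a : opalg := mkop (projT2 (cid (opset_star a))).1.

Lemma opalg_star_adj a : adjoint_op a (opalg_star a).
Proof. exact: (projT2 (cid (opset_star a))).2. Qed.

Lemma opalg_star_uniq a b : adjoint_op a b -> opalg_star a = b.
Proof.
move=> ab; apply: val_inj; exact: adjoint_uniq (opalg_star_adj a) ab.
Qed.

Lemma opalg_mulE a b x : opalg_mul a b x = a (b x).
Proof. by []. Qed.

Lemma opalg_mulA : associative opalg_mul.
Proof. by move=> a b c; apply: opalg_eq => x; rewrite !opalg_mulE. Qed.

Lemma opalg_mulDl : left_distributive opalg_mul +%R.
Proof. by move=> a b c; apply: opalg_eq => x; rewrite opalgDE !opalg_mulE opalgDE. Qed.

Lemma opalg_mulDr : right_distributive opalg_mul +%R.
Proof.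
move=> a b c; apply: opalg_eq => x; rewrite opalgDE !opalg_mulE opalgDE.
by rewrite (bounded_linD (opalg_bounded a)).
Qed.

Lemma opalg_scalerAl (c : R[i]) a b : c *: opalg_mul a b = opalg_mul (c *: a) b.
Proof. by apply: opalg_eq => x; rewrite opalgZE !opalg_mulE opalgZE. Qed.

Lemma opalg_scalerAr (c : R[i]) a b : c *: opalg_mul a b = opalg_mul a (c *: b).
Proof.
apply: opalg_eq => x; rewrite opalgZE !opalg_mulE opalgZE.
by rewrite (bounded_linZ (opalg_bounded a)).
Qed.

Lemma opalg_starK : involutive opalg_star.
Proof. by move=> a; apply: opalg_star_uniq; apply: adjoint_sym; exact: opalg_star_adj. Qed.

Lemma opalg_starD : {morph opalg_star : a b / a + b}.
Proof.
move=> a b; apply: opalg_star_uniq => x y.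
by rewrite !opalgDE l2innerDl l2innerDr !opalg_star_adj.
Qed.

Lemma opalg_starZ (c : R[i]) a : opalg_star (c *: a) = c^* *: opalg_star a.
Proof.
apply: opalg_star_uniq => x y.
by rewrite !opalgZE l2innerZl l2innerZr opalg_star_adj.
Qed.

Lemma opalg_starM a b :
  opalg_star (opalg_mul a b) = opalg_mul (opalg_star b) (opalg_star a).
Proof.
apply: opalg_star_uniq; exact: adjoint_comp (opalg_star_adj a) (opalg_star_adj b).
Qed.

Lemma opalg_normM a b : `|opalg_mul a b| <= `|a| * `|b|.
Proof.
rewrite !opalg_normE -rmorphM lecR; apply: opnorm_le => [|x].
  by rewrite mulr_ge0 ?opnorm_ge0//; exact: opalg_bounded.
apply: le_trans (opnormP _ (opalg_bounded a)) _.
by rewrite -mulrA ler_wpM2l ?opnorm_ge0 ?opnormP//; exact: opalg_bounded.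
Qed.

(** |a x|^2 = <x, a^* a x> gives |a|^2 <= |a^* a|; the other inequality follows
    from |a^*| <= |a|. *)
Lemma opalg_norm_star a : `|opalg_mul (opalg_star a) a| = `|a| ^+ 2.
Proof.
have ba := opalg_bounded a; have n0 := opnorm_ge0 ba.
have bs := opalg_bounded (opalg_star a).
have bm := opalg_bounded (opalg_mul (opalg_star a) a).
have star_le : opnorm (opalg_star a) <= opnorm a.
  apply: opnorm_le => // x; apply: adjoint_bound (opalg_star_adj a) _ => // y.
  exact: opnormP.
apply/eqP; rewrite eq_le; apply/andP; split.
  apply: le_trans (opalg_normM _ _) _.
  by rewrite expr2 ler_wpM2r ?normr_ge0// !opalg_normE lecR.
rewrite !opalg_normE -rmorphXn lecR; set N := opnorm (opalg_mul _ _).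
have N0 : 0 <= N by exact: opnorm_ge0.
rewrite -[leRHS]sqr_sqrtr// ler_pXn2r ?nnegrE ?sqrtr_ge0//.
apply: opnorm_le => [|x]; first exact: sqrtr_ge0.
rewrite -(@ler_pXn2r _ 2)// ?nnegrE ?mulr_ge0 ?sqrtr_ge0 ?l2norm_ge0//.
rewrite exprMn (sqr_sqrtr N0).
have ax : l2inner x (opalg_mul (opalg_star a) a x) = (l2norm (a x) ^+ 2)%:C.
  by rewrite opalg_mulE -opalg_star_adj l2inner_self.
have := cauchy_schwarz x (opalg_mul (opalg_star a) a x).
rewrite ax normc_real ger0_norm ?sqr_ge0// => ax_le.
apply: le_trans ax_le _; rewrite expr2 mulrCA; apply: ler_wpM2l; first exact: l2norm_ge0.
exact: opnormP.
Qed.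

HB.instance Definition _ := CompleteNormedModule_isCStarAlgebra.Build R opalg
  opalg_mulA opalg_mulDl opalg_mulDr opalg_scalerAl opalg_scalerAr
  opalg_starK opalg_starD opalg_starZ opalg_starM opalg_normM opalg_norm_star.

End opset_algebra.

(** * Consequences of the relations *)

Section relations.
Variables (R : realType) (A : cstarAlgType R) (t : nat -> A).
Hypothesis rel_t : wm_relations t.

Definition rproj k : A := cmul (t k) (cstar (t k)).

Lemma rel_pi i : cmul (rproj i) (t i) = t i.
Proof. by case: rel_t => h _ _ _; exact: h. Qed.

Lemma rel_orth i j : i != j -> cmul (cstar (t i)) (t j) = 0.
Proof. by case: rel_t => _ h _ _; exact: h. Qed.

Lemma rel_source i : cmul (cstar (t i)) (t i) = \sum_(k < i.+1) rproj k.
Proof. by case: rel_t => _ _ h _; exact: h. Qed.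

Lemma rel_vac : t 0%N = rproj 0.
Proof. by case: rel_t. Qed.

Lemma rproj_star k : cstar (rproj k) = rproj k.
Proof. by rewrite /rproj cstarM cstarK. Qed.

Lemma rproj_idem k : cmul (rproj k) (rproj k) = rproj k.
Proof. by rewrite {2}/rproj cmulA rel_pi. Qed.

Lemma rproj_gen k j : k != j -> cmul (rproj k) (t j) = 0.
Proof. by move=> kj; rewrite -cmulA rel_orth// cmul0r. Qed.

Lemma rproj_orth k j : k != j -> cmul (rproj k) (rproj j) = 0.
Proof. by move=> kj; rewrite {2}/rproj cmulA rproj_gen// cmul0l. Qed.

(** The initial projection of t i is the sum of the p_k with k <= i; so t i only
    sees the ranges of the letters up to i. This is what makes products of letters
    vanish unless they are weakly decreasing. *)
Lemma gen_source i : t i = cmul (t i) (\sum_(k < i.+1) rproj k).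
Proof. by rewrite -rel_source cmulA rel_pi. Qed.

Lemma source_absorb i j (x : A) :
  cmul (\sum_(k < i.+1) rproj k) (cmul (rproj j) x) =
  if (j <= i)%N then cmul (rproj j) x else 0.
Proof.
rewrite cmul_suml; case: leqP => ji.
  rewrite (bigD1 (Ordinal (ji : j < i.+1)%N))//= cmulA rproj_idem.
  rewrite big1 ?addr0// => k; rewrite -val_eqE /= => kj.
  by rewrite cmulA rproj_orth// cmul0l.
rewrite big1// => k _; rewrite cmulA rproj_orth ?cmul0l//.
by rewrite neq_ltn (leq_ltn_trans _ ji)// -ltnS.
Qed.

Definition act (U : seq nat) (x : A) : A := foldr (fun i => cmul (t i)) x U.

Lemma act_cmul U x y : cmul (act U x) y = act U (cmul x y).
Proof. by elim: U => [//|u U ih] /=; rewrite -cmulA ih. Qed.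

Lemma act_rcons U k x : act (rcons U k) x = act U (cmul (t k) x).
Proof. by rewrite /act foldr_rcons. Qed.

(** The range of a nonzero word t_U p_k lies under the range projection of its
    first letter. *)
Lemma act_head U k : cmul (rproj (head k U)) (act U (rproj k)) = act U (rproj k).
Proof. by case: U => [|u U] /=; [exact: rproj_idem|rewrite cmulA rel_pi]. Qed.

Lemma gen_act_zero i U k : (i < head k U)%N -> cmul (t i) (act U (rproj k)) = 0.
Proof.
move=> lt_i; rewrite -act_head gen_source -cmulA source_absorb leqNgt lt_i.
exact: cmul0r.
Qed.

Lemma source_act i U k : (head k U <= i)%N ->
  cmul (cstar (t i)) (cmul (t i) (act U (rproj k))) = act U (rproj k).
Proof. by move=> le_i; rewrite cmulA rel_source -act_head source_absorb le_i. Qed.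

Lemma star_gen_act_zero i U k : i != head k U ->
  cmul (cstar (t i)) (act U (rproj k)) = 0.
Proof. by move=> ne; rewrite -act_head !cmulA rel_orth// !cmul0l. Qed.

Lemma star_vac : cstar (t 0%N) = t 0%N.
Proof. by rewrite rel_vac rproj_star. Qed.

(** A self-adjoint idempotent p satisfies |p|^2 = |p|. *)
Lemma nm_rproj k : nm (rproj k) <= 1.
Proof.
have := nm_starM (rproj k); rewrite rproj_star rproj_idem.
have := nm_ge0 (rproj k); nra.
Qed.

Lemma nm_gen i : nm (t i) <= 1.
Proof.
have := nm_starM (cstar (t i)); rewrite cstarK nm_star -/(rproj i) => h.
have := nm_rproj i; have := nm_ge0 (t i); nra.
Qed.

Lemma nm_act U k : nm (act U (rproj k)) <= 1.
Proof.
elim: U => [|u U ih] /=; first exact: nm_rproj.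
apply: le_trans (nmM _ _) _; rewrite -[leRHS]mulr1.
by apply: ler_pM => //; rewrite ?nm_ge0 ?nm_gen.
Qed.

End relations.

(** * Monomials and uniform normal forms *)

(** The triple (U, k, V) stands for the monomial t_U p_k t_V^*. *)
Notation code := (seq nat * nat * seq nat)%type.

Section monomials.
Variable R : realType.
Implicit Types (A B : cstarAlgType R).

Definition mon A (t : nat -> A) (f : code) : A :=
  let: (U, k, V) := f in cmul (act t U (rproj t k)) (cstar (act t V (rproj t k))).

Definition comb A (t : nat -> A) (L : seq (R[i] * code)) : A :=
  \sum_(e <- L) e.1 *: mon t e.2.

(** The word U k is weakly decreasing with letters at most n, and the letter 0
    may occur only as its last letter k. As t 0 is idempotent, repeated zeros would
    give several codes for the same monomial. *)
Definition ok_word n k (U : seq nat) : bool :=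
  [&& (k <= n)%N, all (fun i => 0 < i <= n)%N U & sorted geq (rcons U k)].

Definition ok_code n d (f : code) : bool :=
  let: (U, k, V) := f in
  [&& ok_word n k U, ok_word n k V, (size U <= d)%N & (size V <= d)%N].

(** F is thought of as a *-polynomial; its coefficients on the monomials are
    required to be the same in all C*-algebras with a family t satisfying the
    relations. *)
Definition spanned (P : pred code) (F : forall A, (nat -> A) -> A) : Prop :=
  exists2 L : seq (R[i] * code), all (fun e => P e.2) L &
    forall A (t : nat -> A), wm_relations t -> F A t = comb t L.

Definition rep n d := spanned (ok_code n d).

Lemma ok_word_cons n k U i :
  ok_word n k (i :: U) = [&& (0 < i <= n)%N, (head k U <= i)%N & ok_word n k U].
Proof.
rewrite /ok_word /=; case: (k <= n)%N => //=; last by rewrite !andbF.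
by case: U => [|u U] /=; rewrite -?andbA; do !bool_congr; rewrite ?andbT //; rewrite andbCA.
Qed.

Lemma ok_codeS n d d' f : (d <= d')%N -> ok_code n d f -> ok_code n d' f.
Proof.
move=> dd'; case: f => [[U k] V]; rewrite /ok_code => /and4P[-> -> /= Ud Vd].
by rewrite !(leq_trans _ dd').
Qed.

Lemma ok_codeSn n n' d f : (n <= n')%N -> ok_code n d f -> ok_code n' d f.
Proof.
move=> nn'; have okW k U : ok_word n k U -> ok_word n' k U.
  move=> /and3P[kn Un sU]; rewrite /ok_word (leq_trans kn nn') sU andbT/=.
  by apply: sub_all Un => i /andP[-> /= /leq_trans]; apply.
by case: f => [[U k] V] /and4P[/okW oU /okW oV Ud Vd]; apply/and4P.
Qed.

Lemma repS n d n' d' F : (n <= n')%N -> (d <= d')%N -> rep n d F -> rep n' d' F.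
Proof.
move=> nn' dd' [L oL FL]; exists L => //; apply: sub_all oL => e.
by move=> /(ok_codeS dd') /(ok_codeSn nn').
Qed.

Lemma eq_spanned P F G : (forall A (t : nat -> A), wm_relations t -> F A t = G A t) ->
  spanned P F -> spanned P G.
Proof. by move=> FG [L oL FL]; exists L => // A t rt; rewrite -FG// FL. Qed.

Lemma spanned0 P : spanned P (fun A t => 0).
Proof. by exists [::] => // A t _; rewrite /comb big_nil. Qed.

Lemma spanned_mon (P : pred code) f : P f -> spanned P (fun A t => mon t f).
Proof.
move=> Pf; exists [:: (1, f)]; first by rewrite /= Pf.
by move=> A t _; rewrite /comb big_seq1 scale1r.
Qed.

Lemma spanned_lin P (c : R[i]) F G : spanned P F -> spanned P G ->
  spanned P (fun A t => c *: F A t + G A t).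
Proof.
move=> [L oL FL] [K oK GK]; exists ([seq (c * e.1, e.2) | e <- L] ++ K).
  by rewrite all_cat all_map; apply/andP.
move=> A t rt; rewrite FL// GK// /comb big_cat big_map; congr (_ + _).
by rewrite scaler_sumr; apply: eq_bigr => e _; rewrite scalerA.
Qed.

Lemma spanned_sum P (I : Type) (r : seq I) (F : I -> forall A, (nat -> A) -> A) :
  (forall i, spanned P (F i)) -> spanned P (fun A t => \sum_(i <- r) F i A t).
Proof.
move=> rF; elim: r => [|i r ih].
  by apply: eq_spanned (spanned0 P) => A t _; rewrite big_nil.
by apply: eq_spanned (spanned_lin 1 (rF i) ih) => A t _; rewrite big_cons scale1r.
Qed.

Lemma rep_star n d F : rep n d F -> rep n d (fun A t => cstar (F A t)).
Proof.
move=> [L oL FL]; exists [seq (e.1^*, (e.2.2, e.2.1.2, e.2.1.1)) | e <- L].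
  by rewrite all_map; apply: sub_all oL => -[c [[U k] V]] /= /and4P[-> -> -> ->].
move=> A t rt; rewrite FL// /comb cstar_sum big_map; apply: eq_bigr.
by move=> [c [[U k] V]] _ /=; rewrite cstarZ cstarM cstarK.
Qed.

Lemma spanned_lmul (P Q : pred code) (X : forall A, (nat -> A) -> A) F :
  (forall f, P f -> spanned Q (fun A t => cmul (X A t) (mon t f))) ->
  spanned P F -> spanned Q (fun A t => cmul (X A t) (F A t)).
Proof.
move=> hX [L oL FL].
have : spanned Q (fun A t => cmul (X A t) (comb t L)).
  elim: L oL {F FL} => [_|e L ih /= /andP[oe oL]].
    by apply: eq_spanned (spanned0 Q) => A t _; rewrite /comb big_nil cmul0r.
  apply: eq_spanned (spanned_lin e.1 (hX _ oe) (ih oL)) => A t _.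
  by rewrite /comb big_cons cmulDr cscalerAr.
by apply: eq_spanned => A t rt; rewrite FL.
Qed.

Lemma ok_word_rcons n j k V : (j <= k)%N -> (0 < k)%N -> ok_word n k V ->
  ok_word n j (rcons V k).
Proof.
move=> jk k0 /and3P[kn Vn sV]; rewrite /ok_word (leq_trans jk kn) all_rcons k0 kn Vn /=.
by case: V sV {Vn} => [|v V] /= sV; rewrite ?jk// rcons_path last_rcons sV.
Qed.

(** A letter in front of a monomial either extends its word on the left or kills
    it; only t 0 fixes the monomials with U empty and k = 0. *)
Lemma rep_gen n d F i : (i <= n)%N -> rep n d F ->
  rep n d.+1 (fun A t => cmul (t i) (F A t)).
Proof.
move=> le_in; apply: spanned_lmul => -[[U k] V] /and4P[oU oV Ud Vd].
have zero : (forall A (t : nat -> A), wm_relations t ->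
    cmul (t i) (act t U (rproj t k)) = 0) ->
    rep n d.+1 (fun A t => cmul (t i) (mon t (U, k, V))).
  move=> z; apply: eq_spanned (spanned0 _) => A t rt.
  by rewrite /mon cmulA z// cmul0l.
have [lt_i|le_i] := ltnP i (head k U).
  by apply: zero => A t rt; exact: gen_act_zero.
have [i0|i_gt0] := posnP i.
  have U0 : U = [::].
    case: U oU le_i {Ud zero} => [//|u U]; rewrite ok_word_cons i0 /=.
    by move=> /and3P[]; case: u => [|u].
  rewrite U0 /= i0 leqn0 in le_i; have k0 := eqP le_i; subst k U i.
  have oc : ok_code n d.+1 ([::], 0%N, V) by apply/and4P; split=> //; exact: leqW.
  apply: eq_spanned (spanned_mon oc) => A t rt.
  by rewrite /mon /= cmulA (rel_vac rt) rproj_idem.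
have oc : ok_code n d.+1 (i :: U, k, V).
  by apply/and4P; split=> //; [rewrite ok_word_cons i_gt0 le_in le_i|exact: leqW].
by apply: eq_spanned (spanned_mon oc) => A t rt; rewrite /mon /= cmulA.
Qed.

(** The adjoint of a letter i strips the first letter of U. If U is empty and
    k = i, then t_k^* p_k t_V^* = sum_(j <= k) p_j t_k^* t_V^*, by the formula
    for the initial projection. *)
Lemma rep_star_gen n d F i : (i <= n)%N -> rep n d F ->
  rep n d.+1 (fun A t => cmul (cstar (t i)) (F A t)).
Proof.
move=> le_in rF; have [->|i_gt0] := posnP i.
  by apply: eq_spanned (rep_gen (leq0n n) rF) => A t rt; rewrite star_vac.
apply: spanned_lmul rF => -[[U k] V] /and4P[oU oV Ud Vd].
have [ne0|ne_i] := eqVneq (head k U) i; last first.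
  apply: eq_spanned (spanned0 _) => A t rt.
  by rewrite /mon cmulA star_gen_act_zero 1?eq_sym// cmul0l.
case: U oU Ud ne0 => [|u U] oU /= Ud ne0; subst i; last first.
  move: oU; rewrite ok_word_cons => /and3P[u0 Uu oU].
  have oc : ok_code n d.+1 (U, k, V) by apply/and4P; split=> //; [exact/leqW/ltnW|exact: leqW].
  by apply: eq_spanned (spanned_mon oc) => A t rt; rewrite /mon /= cmulA source_act.
have oc (j : 'I_k.+1) : ok_code n d.+1 ([::], j : nat, rcons V k).
  have jk : (j <= k)%N by rewrite -ltnS.
  have kn : (k <= n)%N by case/and3P: oV.
  apply/and4P; split=> //; first by rewrite /ok_word (leq_trans jk kn).
    exact: ok_word_rcons.
  by rewrite size_rcons ltnS.
apply: eq_spanned (spanned_sum _ (fun j => spanned_mon (oc j))) => A t rt.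
rewrite /mon /= cmulA {1}/rproj cmulA rel_source// -cmulA -cstarM act_cmul rel_pi//.
rewrite cmul_suml; apply: eq_bigr => j _.
by rewrite act_rcons -act_cmul cstarM -/(rproj t j) rproj_star cmulA rproj_idem.
Qed.

(** Insert t_k^* t_k = sum_(j <= k) p_j in the middle of
    t_U p_k t_V^* = t_U t_k (t_k^* t_k) t_k^* t_V^*. *)
Lemma mon_expand U k V A (t : nat -> A) : wm_relations t ->
  mon t (U, k, V) = \sum_(j < k.+1) mon t (rcons U k, j : nat, rcons V k).
Proof.
have idem2 (x p y : A) : cmul p p = p -> cmul (cmul x p) y = cmul (cmul x p) (cmul p y).
  by move=> pp; rewrite -[LHS]cmulA -[RHS]cmulA [cmul p (cmul p y)]cmulA pp.
move=> rt; rewrite /mon /rproj -!act_cmul !cstarM cstarK.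
rewrite cmulA -(cmulA (act t U (t k))) rel_source// cmul_sumr cmul_suml.
apply: eq_bigr => j _; rewrite !act_rcons -!(act_cmul _ _ _ (rproj t j)) cstarM.
by rewrite rproj_star; exact: idem2 (rproj_idem rt j).
Qed.

Lemma rep_act n d F U : all (fun i => i <= n)%N U -> rep n d F ->
  rep n (size U + d) (fun A t => act t U (F A t)).
Proof.
elim: U => [//|u U ih] /= /andP[un Un] rF; rewrite addSn.
exact: rep_gen (ih Un rF).
Qed.

Lemma rep_rproj n d F k : (k <= n)%N -> rep n d F ->
  rep n d.+2 (fun A t => cmul (rproj t k) (F A t)).
Proof.
move=> kn rF; apply: eq_spanned (rep_gen kn (rep_star_gen kn rF)) => A t _.
by rewrite cmulA.
Qed.

Lemma rep_star_act n d F V k : (k <= n)%N -> all (fun i => i <= n)%N V -> rep n d F ->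
  rep n (size V + d).+2 (fun A t => cmul (cstar (act t V (rproj t k))) (F A t)).
Proof.
move=> kn; elim: V d F => [|v V ih] d F /=.
  move=> _ rF; apply: eq_spanned (rep_rproj kn rF) => A t rt.
  by rewrite rproj_star.
move=> /andP[vn Vn] rF; rewrite addSnnS.
by apply: eq_spanned (ih _ _ Vn (rep_star_gen vn rF)) => A t rt; rewrite cstarM -cmulA.
Qed.

(** A monomial acts from the left as a succession of letters and adjoints of
    letters, at most 2 d + 4 of them. The argument is applied to the adjoint of
    the product, as left multiplications are the ones at hand. *)
Lemma rep_mul n d d' F G : rep n d F -> rep n d' G ->
  rep n (2 * d + d' + 4) (fun A t => cmul (F A t) (G A t)).
Proof.
move=> rF rG.
have le_word k U : ok_word n k U -> all (fun i => i <= n)%N U.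
  by move=> /and3P[_ + _]; apply: sub_all => i /andP[].
have : rep n (2 * d + d' + 4)
    (fun A t => cstar (cmul (cstar (G A t)) (cstar (F A t)))).
  apply: rep_star; apply: spanned_lmul (rep_star rF) => -[[U k] V] /and4P[oU oV Ud Vd].
  have kn : (k <= n)%N by case/and3P: oU.
  have := rep_star (rep_act (le_word _ _ oV) (rep_rproj kn (rep_star_act kn (le_word _ _ oU) rG))).
  move=> /(@repS _ _ n (2 * d + d' + 4) _ (leqnn n)) r.
  apply: eq_spanned (r _) => [A t rt|].
    have starE (x y g : A) :
        cstar (cmul x (cmul (cstar y) g)) = cmul (cstar g) (cmul y (cstar x)).
      by rewrite !cstarM cstarK cmulA.
    by rewrite -(act_cmul t V (rproj t k)); exact: starE.
  by rewrite !addnS addn0 !ltnS mul2n -addnn addnCA -!addnA leq_add// leq_add.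
by apply: eq_spanned => A t rt; rewrite cstarM !cstarK.
Qed.

Lemma rep_sqr n d F : rep n d F ->
  rep n (3 * d + 4) (fun A t => cmul (cstar (F A t)) (F A t)).
Proof.
move=> rF; apply: repS (rep_mul (rep_star rF) rF) => //.
by rewrite (mulnDl 2 1) mul1n.
Qed.

Lemma nm_mon A (t : nat -> A) f : wm_relations t -> nm (mon t f) <= 1.
Proof.
move=> rt; case: f => [[U k] V]; apply: le_trans (nmM _ _) _.
by rewrite nm_star -[leRHS]mulr1; apply: ler_pM; rewrite ?nm_ge0 ?nm_act.
Qed.

End monomials.

(** * Canonical monomials and polynomial growth *)

Section canonical_form.
Variable R : realType.
Implicit Types (A B : cstarAlgType R).

(** The expansion of mon_expand stops at k = 0, where it is trivial, and at
    words U of length d; it adds at most d letters to V. *)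
Definition canonical n d (f : code) : bool :=
  let: (U, k, V) := f in
  [&& ok_word n k U, ok_word n k V, (size U <= d)%N, (size V <= 2 * d)%N &
      (k == 0%N) || (size U == d)].

Lemma mon_canonical n d U k V : ok_word n k U -> ok_word n k V ->
  (size U <= d)%N -> (size V <= d + size U)%N ->
  spanned (canonical n d) (fun A (t : nat -> A) => mon t (U, k, V)).
Proof.
move=> oU oV Ud Vd; have := subnK Ud; move: (d - size U)%N => e.
elim: e U k V oU oV Vd {Ud} => [|e ih] U k V oU oV Vd.
  rewrite add0n => dE; apply: spanned_mon.
  by rewrite /canonical oU oV dE leqnn mul2n -addnn -{2}dE Vd eqxx orbT.
move=> dE; have [k0|k_gt0] := posnP k.
  apply: spanned_mon; rewrite /canonical oU oV k0 eqxx /= andbT.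
  have Ud : (size U <= d)%N by rewrite -dE leq_addl.
  by rewrite Ud (leq_trans Vd)// mul2n -addnn leq_add2l.
have sp (j : 'I_k.+1) : spanned (canonical n d)
    (fun A (t : nat -> A) => mon t (rcons U k, j : nat, rcons V k)).
  have jk : (j <= k)%N by rewrite -ltnS.
  apply: ih; rewrite ?size_rcons; [ | |by rewrite addnS|by rewrite -dE addSnnS].
    exact: ok_word_rcons.
  exact: ok_word_rcons.
apply: eq_spanned (spanned_sum _ sp) => A t rt.
by rewrite (mon_expand U k V rt).
Qed.

Lemma rep_spanned_canonical n d (F : forall A, (nat -> A) -> A) :
  rep n d F -> spanned (canonical n d) F.
Proof.
move=> [L oL FL]; have : spanned (canonical n d) (fun A t => comb t L).
  elim: L oL {FL} => [_|[c [[U k] V]] L ih /= /andP[/and4P[oU oV Ud Vd] oL]].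
    by apply: eq_spanned (spanned0 R (canonical n d)) => A t _; rewrite /comb big_nil.
  have sp := mon_canonical oU oV Ud (leq_trans Vd (leq_addr _ _)).
  apply: eq_spanned (spanned_lin c sp (ih oL)) => A t _.
  by rewrite /comb big_cons.
by apply: eq_spanned => A t rt; rewrite FL.
Qed.

(** A weakly decreasing word is determined by the multiplicities of its letters.
    This is the reason why there are polynomially many of them. *)
Lemma ok_word_uniq n k U V m :
  ok_word n k U -> ok_word n k V -> (size U <= m)%N -> (size V <= m)%N ->
  [ffun i : 'I_n.+1 => inord (count_mem (i : nat) U) : 'I_m.+1] =
  [ffun i : 'I_n.+1 => inord (count_mem (i : nat) V) : 'I_m.+1] -> U = V.
Proof.
move=> /and3P[_ Un sU] /and3P[_ Vn sV] Um Vm /ffunP UV.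
have sorted_of W : sorted geq (rcons W k) -> sorted geq W.
  by case: W => [//|w W] /=; rewrite rcons_path => /andP[].
apply: (sorted_eq _ _ (sorted_of _ sU) (sorted_of _ sV)).
- by move=> y x z /= xy yz; exact: leq_trans yz xy.
- by move=> x y /= /andP[yx xy]; apply/eqP; rewrite eqn_leq xy yx.
apply/allP => i _; rewrite /=; have [lt_i|ge_i] := ltnP i n.+1.
  have := UV (Ordinal lt_i); rewrite !ffunE /= => /(congr1 (@nat_of_ord _)).
  by rewrite !inordK ?ltnS ?(leq_trans (count_size _ _))// => ->.
have notin W : all (fun j => 0 < j <= n)%N W -> count_mem i W = 0%N.
  move=> Wn; apply/count_memPn/negP => /(allP Wn) /andP[_].
  by rewrite leqNgt ge_i.
by rewrite !notin.
Qed.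

Definition code_bound n d := (n.+1 * ((2 * d).+1 ^ n.+1 * (2 * d).+1 ^ n.+1))%N.

Lemma size_canonical n d (S : seq code) : uniq S -> all (canonical n d) S ->
  (size S <= code_bound n d)%N.
Proof.
move=> uS cS; pose m := (2 * d)%N.
pose cnt (U : seq nat) := [ffun i : 'I_n.+1 => inord (count_mem (i : nat) U) : 'I_m.+1].
pose h (f : code) : 'I_n.+1 * ({ffun 'I_n.+1 -> 'I_m.+1} * {ffun 'I_n.+1 -> 'I_m.+1}) :=
  (inord f.1.2, (cnt f.1.1, cnt f.2)).
have h_inj : {in S &, injective h}.
  move=> [[U k] V] [[U' k'] V'] /(allP cS) /and5P[oU oV Ud Vd _].
  move=> /(allP cS) /and5P[oU' oV' Ud' Vd' _] /= [kk UU VV].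
  have kn W l : ok_word n l W -> (l < n.+1)%N by move=> /and3P[].
  have : k = k' by have := congr1 (@nat_of_ord _) kk; rewrite !inordK ?(kn _ _ oU) ?(kn _ _ oU').
  move=> ?; subst k'.
  have dm : (d <= m)%N by rewrite /m mul2n -addnn leq_addr.
  rewrite (ok_word_uniq oU oU' (leq_trans Ud dm) (leq_trans Ud' dm) UU).
  by rewrite (ok_word_uniq oV oV' Vd Vd' VV).
have -> : code_bound n d = #|{: 'I_n.+1 * ({ffun 'I_n.+1 -> 'I_m.+1} * {ffun 'I_n.+1 -> 'I_m.+1})}|.
  by rewrite !card_prod !card_ffun !card_ord.
rewrite -(size_map h) cardE; apply: uniq_leq_size; first by rewrite map_inj_in_uniq.
by move=> x _; rewrite mem_enum.
Qed.

Definition coef (L : seq (R[i] * code)) f : R[i] := \sum_(e <- L | e.2 == f) e.1.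

Lemma comb_coef A (t : nat -> A) L :
  comb t L = \sum_(f <- undup (map snd L)) coef L f *: mon t f.
Proof.
rewrite (eq_bigr (fun f => \sum_(e <- L | e.2 == f) e.1 *: mon t e.2)); last first.
  by move=> f _; rewrite scaler_suml; apply: eq_bigr => e /eqP ->.
rewrite (exchange_big_dep predT)//= /comb big_seq [RHS]big_seq; apply: eq_bigr => e eL.
rewrite (eq_bigl (fun f => f == e.2)); last by move=> f; rewrite eq_sym.
by rewrite -big_filter filter_pred1_uniq ?undup_uniq ?mem_undup ?map_f// big_seq1.
Qed.

(** With N = 2^k the hypothesis reads x^N <= (M N^2)^q y^N with q = 2^j; the
    exponent q can be removed by replacing N with q N. If y < x, then (x / y)^N
    grows faster than any multiple of N^2. *)
Lemma le_of_power_bound (x y : R) (M j : nat) : 0 <= x -> 0 <= y ->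
  (forall k, x ^+ (2 ^ k) <= (M * 4 ^ k)%:R ^+ (2 ^ j) * y ^+ (2 ^ k)) -> x <= y.
Proof.
move=> x0 y0 hxy; rewrite leNgt; apply/negP => lt_yx.
pose C : R := (M * 4 ^ j)%:R.
have hN m : x ^+ (2 ^ m) <= C * (2 ^ m)%:R ^+ 2 * y ^+ (2 ^ m).
  have j0 : (0 < 2 ^ j)%N by rewrite expn_gt0.
  rewrite -(ler_pXn2r j0) ?nnegrE ?mulr_ge0 ?exprn_ge0//.
  rewrite exprMn -!exprM -expnD; apply: le_trans (hxy (m + j)%N) _.
  rewrite [leLHS]mulrC [leRHS]mulrC ler_wpM2l ?exprn_ge0// ler_pXn2r ?nnegrE ?mulr_ge0 ?exprn_ge0//.
  rewrite /C -natrX -natrM ler_nat -expnM [(m * 2)%N]mulnC expnM.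
  by rewrite expnD -!mulnA [(4 ^ j * _)%N]mulnC.
have y_gt0 : 0 < y.
  rewrite lt_def y0 andbT; apply: contraTneq (hN 0%N) => y_eq0.
  by rewrite y_eq0 expn0 !expr1 mulr0 -ltNge (le_lt_trans y0).
pose z := x / y - 1; have z0 : 0 < z by rewrite subr_gt0 ltr_pdivlMr// mul1r.
have bern n : 1 + n%:R * z <= (1 + z) ^+ n.
  elim: n => [|n ih]; first by rewrite mul0r addr0 expr0.
  rewrite exprS; apply: (@le_trans _ _ ((1 + z) * (1 + n%:R * z))).
    rewrite -natr1; have : 0 <= n%:R :> R by []. 
    set a : R := n%:R => a0; nra.
  by rewrite ler_pM2l// addr_gt0.
have zN m : (1 + z) ^+ (2 ^ m) <= C * (2 ^ m)%:R ^+ 2.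
  rewrite /z addrCA subrr addr0 expr_div_n ler_pdivrMr ?exprn_gt0//.
(* Bernoulli, raised to the fourth power, beats N^2 *)
have bound m : z ^+ 4 * (2 ^ m)%:R ^+ 2 <= 16 * C.
  have := zN (m + 2)%N; rewrite expnD natrM exprM -[(2 ^ 2)%N]/4%N.
  set N : R := (2 ^ m)%:R; have N0 : 0 < N by rewrite ltr0n expn_gt0.
  have := bern (2 ^ m)%N; rewrite -/N; set w := (1 + z) ^+ _ => Nw w4.
  have Nz : 0 <= N * z by rewrite mulr_ge0// ltW.
  have wNz : (N * z) ^+ 4 <= w ^+ 4.
    by rewrite ler_pXn2r ?nnegrE//; lra.
  have lhsE : z ^+ 4 * N ^+ 2 * N ^+ 2 = (N * z) ^+ 4 by rewrite exprMn; ring.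
  have rhsE : 16 * C * N ^+ 2 = C * (N * 4%:R) ^+ 2 by rewrite exprMn; ring.
  by rewrite -(ler_pM2r (exprn_gt0 2 N0)) lhsE rhsE; exact: le_trans wNz w4.
have [n nC] : exists n, 16 * C / z ^+ 4 < n%:R.
  by exists (Num.truncn (16 * C / z ^+ 4)).+1; exact: truncnS_gt.
have := bound n; rewrite mulrC -ler_pdivlMr ?exprn_gt0// => le_n.
have n_lt : n%:R < (2 ^ n)%:R :> R by rewrite ltr_nat ltn_expl.
have N1 : 1 <= (2 ^ n)%:R :> R by rewrite ler1n expn_gt0.
set N : R := (2 ^ n)%:R in le_n n_lt N1; set Q : R := _ / _ in le_n nC.
have : N * 1 <= N * N by rewrite ler_pM2l// (lt_le_trans ltr01).
rewrite expr2 in le_n; set m : R := n%:R in nC n_lt; lra.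
Qed.

(** A family s whose algebra admits functionals dual to the canonical monomials
    dominates every other family with the relations. *)

Section domination.
Variables (A : cstarAlgType R) (s : nat -> A).
Hypothesis rel_s : wm_relations s.
Variable entry : code -> A -> R[i].
Hypothesis entry_lin : forall f (c : R[i]) (x y : A),
  entry f (c *: x + y) = c * entry f x + entry f y.
Hypothesis entry_le : forall f x, normc (entry f x) <= nm x.
Hypothesis entry_mon : forall n d f f', canonical n d f -> canonical n d f' ->
  entry f (mon s f') = (f' == f)%:R.

Lemma entry_comb n d L f : all (fun e => canonical n d e.2) L -> canonical n d f ->
  entry f (comb s L) = coef L f.
Proof.
move=> cL cf; elim: L cL => [_|[c g] L ih /= /andP[cg cL]].
  rewrite /comb /coef !big_nil; have := entry_lin f (-1) 0 0.
  by rewrite scaleN1r oppr0 addr0 mulN1r addNr.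
rewrite /comb big_cons entry_lin -/(comb s L) ih// (entry_mon cf cg).
by rewrite /coef big_cons /=; case: (g == f); rewrite ?mulr1// mulr0 add0r.
Qed.

(** The coefficients on canonical monomials are the values of the functionals
    entry f at F(s), and there are at most code_bound n d of them. *)
Lemma rep_poly_bound n d F B (t : nat -> B) : rep n d F -> wm_relations t ->
  nm (F B t) <= (code_bound n d)%:R * nm (F A s).
Proof.
move=> /rep_spanned_canonical[L cL FL] rt; rewrite !FL// comb_coef.
set S := undup _; have cS : all (canonical n d) S.
  by apply/allP => f; rewrite mem_undup => /mapP[e eL ->]; exact: (allP cL).
apply: le_trans (nm_sum _ _ _) _; rewrite big_seq.
apply: (@le_trans _ _ (\sum_(f <- S | f \in S) nm (comb s L))).
  apply: ler_sum => f fS; rewrite nmZ -(entry_comb cL (allP cS f fS)).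
  rewrite -[leRHS]mulr1; apply: ler_pM; rewrite ?normc_ge0 ?nm_ge0//.
  exact: nm_mon.
rewrite -big_seq big_const_seq iter_addr_0 -size_filter filter_predT -[leLHS]mulr_natl.
by rewrite ler_wpM2r ?nm_ge0// ler_nat size_canonical// undup_uniq.
Qed.

Fixpoint sqr_iter k (F : forall A : cstarAlgType R, (nat -> A) -> A) :
    forall A : cstarAlgType R, (nat -> A) -> A :=
  if k is k'.+1 then fun A t => cmul (cstar (sqr_iter k' F t)) (sqr_iter k' F t)
  else F.

Lemma nm_sqr_iter k F B (t : nat -> B) :
  nm (sqr_iter k F t) = nm (F B t) ^+ (2 ^ k).
Proof.
elim: k => [|k ih] /=; first by rewrite expr1.
by rewrite nm_starM ih -exprM expnSr.
Qed.

Lemma rep_sqr_iter n d F k : rep n d F -> rep n (3 ^ k * (d + 2)) (sqr_iter k F).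
Proof.
move=> rF; suff : exists2 e, (e + 2 = 3 ^ k * (d + 2))%N & rep n e (sqr_iter k F).
  by move=> [e <-]; apply: repS => //; exact: leq_addr.
elim: k => [|k [e ek re]] /=; first by exists d; rewrite ?mul1n.
exists (3 * e + 4)%N; last exact: rep_sqr.
by rewrite expnS -mulnA -ek mulnDr -addnA.
Qed.

(** The polynomial factor of the previous bound is removed by applying it to
    iterated squares F^* F: the degree is multiplied by 3 at each step, up to a
    constant, and the exponent of the norm by 2. *)
Lemma nm_domination n d F B (t : nat -> B) : rep n d F -> wm_relations t ->
  nm (F B t) <= nm (F A s).
Proof.
move=> rF rt; pose q := (2 * n.+1)%N; pose M := (n.+1 * (2 * (d + 2)).+1)%N.
apply: (@le_of_power_bound _ _ M q); rewrite ?nm_ge0// => k.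
(* (n + 1) (2 D + 1)^(2 n + 2) with D = 3^k (d + 2) is at most (M 4^k)^q. *)
rewrite -!nm_sqr_iter; apply: le_trans (rep_poly_bound (rep_sqr_iter k rF) rt) _.
rewrite ler_wpM2r ?nm_ge0// -natrX ler_nat /code_bound -expnD addnn -mul2n -/q.
set D := (3 ^ k * (d + 2))%N.
have le34 : (3 ^ k <= 4 ^ k)%N by case: (k) => // k'; rewrite leq_exp2r.
have MD : (n.+1 * (2 * D).+1 <= M * 4 ^ k)%N.
  rewrite /M -mulnA leq_mul2l /=; apply: (@leq_trans ((2 * (d + 2)).+1 * 3 ^ k)%N).
    by rewrite [leqRHS]mulSn /D -mulnA [((d + 2) * _)%N]mulnC -add1n leq_add2r expn_gt0.
  by rewrite leq_mul2l le34 orbT.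
have q0 : (0 < q)%N by rewrite /q mul2n double_gt0.
apply: (@leq_trans ((M * 4 ^ k) ^ q)%N).
  apply: (@leq_trans ((n.+1 * (2 * D).+1) ^ q)%N); last by rewrite leq_exp2r.
  by rewrite expnMn leq_mul2r -{1}(expn1 n.+1) leq_pexp2l// orbT.
rewrite leq_pexp2l//; first by rewrite (leq_trans _ MD).
by rewrite ltnW// ltn_expl.
Qed.

End domination.

End canonical_form.

(** * Annihilators and the operator algebra *)

Section reindexing.
Variables (R : realType) (I : choiceType) (P : set I) (g : I -> I).
Hypothesis g_inj : {in P &, injective g}.

Lemma esum_reindex (F G : I -> \bar R) :
  (forall i, 0 <= F i)%E -> (forall i, 0 <= G i)%E ->
  (forall i, P i -> F i = G (g i)) -> (forall i, ~ P i -> F i = 0%E) ->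
  (forall j, ~ (g @` P) j -> G j = 0%E) ->
  (\esum_(i in [set: I]) F i = \esum_(i in [set: I]) G i)%E.
Proof.
move=> F0 G0 FG FP GP.
rewrite (esumID P)// [X in (_ + X)%E]esum1 ?adde0; last by move=> i [_ /FP].
rewrite [RHS](esumID (g @` P))// [X in (_ + X)%E]esum1 ?adde0; last by move=> i [_ /GP].
by rewrite !setTI esum_image//; exact: eq_esum.
Qed.

Lemma rsum_reindex (f h : I -> R) :
  (forall i, P i -> f i = h (g i)) -> (forall i, ~ P i -> f i = 0) ->
  (forall j, ~ (g @` P) j -> h j = 0) -> rsum f = rsum h.
Proof.
move=> fh fP hP; rewrite /rsum; congr (fine _ - fine _); apply: esum_reindex => // i.
- by move=> Pi; rewrite !funeposE /= fh.
- by move=> /fP f0; rewrite funeposE /= f0 maxxx.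
- by move=> /hP h0; rewrite funeposE /= h0 maxxx.
- by move=> Pi; rewrite !funenegE /= fh.
- by move=> /fP f0; rewrite funenegE /= f0 ?oppr0 maxxx.
- by move=> /hP h0; rewrite funenegE /= h0 ?oppr0 maxxx.
Qed.

Lemma csum_reindex (f h : I -> R[i]) :
  (forall i, P i -> f i = h (g i)) -> (forall i, ~ P i -> f i = 0) ->
  (forall j, ~ (g @` P) j -> h j = 0) -> csum f = csum h.
Proof.
move=> fh fP hP; rewrite /csum; congr (_ +i* _); apply: rsum_reindex => i.
- by move=> /fh ->.
- by move=> /fP ->.
- by move=> /hP ->.
- by move=> /fh ->.
- by move=> /fP ->.
- by move=> /hP ->.
Qed.

End reindexing.

Section generated.
Variables (R : realType) (I : choiceType) (X : set (l2 R I -> l2 R I)).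
Hypothesis X_adj : X `<=` @adjointable R I.

(** The adjointable operators form one of the C*-subalgebras intersected. *)
Lemma op_cstar_generated_adj : op_cstar_generated X `<=` @adjointable R I.
Proof. by move=> T /(_ _ (@adjointable_subalg R I)); exact. Qed.

Lemma op_cstar_generated_subalg : op_cstar_subalg (op_cstar_generated X).
Proof.
split.
- by move=> T /op_cstar_generated_adj[].
- split; first by move=> S [_ [S0 _] _ _ _].
  move=> c T T' hT hT' S SS XS; have [_ [_ SD] _ _ _] := SS.
  by apply: SD; [exact: hT|exact: hT'].
- move=> T T' hT hT' S SS XS; have [_ _ SM _ _] := SS.
  by apply: SM; [exact: hT|exact: hT'].
- move=> T T' hT bT' TT' S SS XS; have [_ _ _ Sadj _] := SS.
  by apply: Sadj bT' TT'; exact: hT.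
- move=> T bT hT S SS XS; have [_ _ _ _ Sc] := SS.
  apply: Sc => // e e0; have [T' gT' TT'] := hT e e0.
  by exists T' => //; exact: gT'.
Qed.

Lemma op_cstar_generated_sub : X `<=` op_cstar_generated X.
Proof. by move=> T XT S _; exact. Qed.

End generated.

Section annihilators.
Variable R : realType.
Local Notation H := (wm_fock R).

Definition nilword : wm_word := exist is_wm_word [::] isT.

(** The empty word gets the head 0, which is no letter: this way p_k is the
    projection onto the words of head k for k = 0 as well. *)
Definition wm_head (w : wm_word) : nat := head 0%N (val w).

Definition wm_cons i (w : wm_word) : option wm_word := insub (i :: val w).

Lemma is_wm_cons i (w : wm_word) : (0 < i)%N ->
  is_wm_word (i :: val w) = (wm_head w <= i)%N.
Proof.
case: w => [[|u w] pw] /= i0; rewrite /wm_head /is_wm_word /= i0//.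
by have /andP[/= -> ->] := pw; rewrite andbT.
Qed.

Lemma wm_consE i (w v : wm_word) : val v = i :: val w -> wm_cons i w = Some v.
Proof. by move=> vE; rewrite /wm_cons -vE valK. Qed.

Definition annihilator_fun i (x : H) : wm_word -> R[i]^o :=
  fun w => if wm_cons i w is Some v then x v else 0.

Definition starts i : set wm_word := [set w | ohead (val w) == Some i].

Lemma starts_inj i : {in starts i &, injective wm_behead}.
Proof.
move=> [[|a u] pu] [[|b v] pv]; rewrite !inE /starts //=.
move=> /eqP ai /eqP bi /(congr1 val) /= uv.
by apply: val_inj; rewrite /= uv; case: ai bi => -> [->].
Qed.

Lemma wm_cons_behead i w : starts i w -> wm_cons i (wm_behead w) = Some w.
Proof.
case: w => [[|a u] pu] //= /eqP[ai]; subst a.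
exact: wm_consE.
Qed.

Lemma wm_cons_none i v : ~ (wm_behead @` starts i) v -> wm_cons i v = None.
Proof.
move=> nv; rewrite /wm_cons; case: insubP => // w _ wE; exfalso; apply: nv.
exists w; first by rewrite /starts /= wE.
by apply: val_inj; rewrite /= wE.
Qed.

Lemma annihilator_subproof i (x : H) : annihilator_fun i x \in @sq_summable R wm_word.
Proof.
rewrite inE; apply: le_lt_trans (l2_sqsum x).
pose F w := if ohead (val w) == Some i then (normc (x w) ^+ 2)%:E else 0%E.
have -> : sqsum (annihilator_fun i x) = (\esum_(w in [set: wm_word]) F w)%E.
  apply/esym; apply: (esum_reindex (@starts_inj i)) => w.
  - by rewrite /F; case: ifP => // _; rewrite lee_fin sqr_ge0.
  - by rewrite lee_fin sqr_ge0.
  - by move=> sw; rewrite /annihilator_fun wm_cons_behead// /F; move: sw => /= ->.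
  - by rewrite /F /starts /=; case: ifP.
  - by move=> /wm_cons_none; rewrite /annihilator_fun => ->; rewrite [normc _]normc0 expr0n.
by apply: le_esum => w _; rewrite /F; case: ifP => // _; rewrite lee_fin sqr_ge0.
Qed.

Definition annihilator i (x : H) : H := L2 (annihilator_subproof i x).

(** The two inner products are the same sum, over the words starting with i on
    one side and over their tails on the other. *)
Lemma creator_adjoint i : adjoint_op (@creator R i) (annihilator i).
Proof.
move=> x y; apply: (csum_reindex (@starts_inj i)) => w.
- move=> sw; rewrite /= /creator_fun /annihilator_fun wm_cons_behead//.
  by move: sw; rewrite /starts /= => ->.
- rewrite /starts /= /creator_fun; case: ifP => // _ _.
  by rewrite (rmorph0 Num.conj) mul0r.
- by move=> /wm_cons_none; rewrite /= /annihilator_fun => ->; rewrite mulr0.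
Qed.

Lemma wm_generators_adjointable :
  [set T | exists2 i, (1 <= i)%N &
    T = @creator R i \/ bounded_op T /\ adjoint_op (creator i) T] `<=` @adjointable R wm_word.
Proof.
move=> T [i _ [->|[bT aT]]]; split=> //.
- exact: creator_bounded.
- by exists (annihilator i); exact: creator_adjoint.
- by exists (creator i); exact: adjoint_sym.
Qed.

End annihilators.

Definition wm_opset (R : realType) : opset R wm_word :=
  OpSet (op_cstar_generated_subalg (@wm_generators_adjointable R))
        (op_cstar_generated_adj (@wm_generators_adjointable R)).

(** * The Fock family *)

Lemma opalg_cstar_adj (R : realType) (I : choiceType) (W : opset R I) (a : opalg W) :
  adjoint_op a (cstar a).
Proof. exact: opalg_star_adj. Qed.

Section fock_generators.
Variable R : realType.
Local Notation H := (wm_fock R).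
Local Notation WA := (opalg (wm_opset R)).
Implicit Types (a b : WA) (w v u : wm_word) (x y : H).

Lemma creator_in i : (0 < i)%N -> wm_cstar R (creator i).
Proof. by move=> i0; apply: op_cstar_generated_sub; exists i => //; left. Qed.

Definition wcreator i : WA := @mkop _ _ (wm_opset R) _ (creator_in (ltn0Sn i)).

(** As e_1 (x) w is a basis word exactly when w is empty or starts with 1, the
    difference A_1 A_1^dagger - A_1^dagger A_1 is the projection onto the vacuum. *)
Definition fgen (i : nat) : WA :=
  if i is j.+1 then wcreator j
  else cmul (cstar (wcreator 0)) (wcreator 0) - cmul (wcreator 0) (cstar (wcreator 0)).

Lemma wa_eq a b : (forall x w, a x w = b x w) -> a = b.
Proof. by move=> ab; apply: opalg_eq => x; apply: l2P => w. Qed.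

Lemma wa_mulE a b x : cmul a b x = a (b x).
Proof. by []. Qed.

Lemma wm_head_starts i w : (0 < i)%N -> (ohead (val w) == Some i) = (wm_head w == i).
Proof. by rewrite /wm_head; case: w => [[|u w] pw] //= i0; rewrite ltn_eqF. Qed.

Lemma fgenE i x w : (0 < i)%N ->
  fgen i x w = if wm_head w == i then x (wm_behead w) else 0.
Proof. by move=> i0; rewrite -wm_head_starts//; case: i i0. Qed.

Lemma fgen_starE i x w : (0 < i)%N ->
  cstar (fgen i) x w = if wm_cons i w is Some v then x v else 0.
Proof.
case: i => // i _; have aW := opalg_cstar_adj (wcreator i).
by rewrite /fgen (adjoint_uniq aW (creator_adjoint i.+1)).
Qed.

Lemma wm_head_cons i w v : wm_cons i w = Some v -> wm_head v = i /\ wm_behead v = w.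
Proof.
rewrite /wm_cons; case: insubP => // v' _ vE [<-]; split; first by rewrite /wm_head vE.
by apply: val_inj; rewrite /= vE.
Qed.

Lemma wm_cons_some i w : (0 < i)%N -> (wm_head w <= i)%N -> exists v, wm_cons i w = Some v.
Proof.
by move=> i0 wi; rewrite /wm_cons insubT ?is_wm_cons// => p; eexists.
Qed.

Lemma wm_cons_nil i w : (0 < i)%N -> (i < wm_head w)%N -> wm_cons i w = None.
Proof. by move=> i0 wi; rewrite /wm_cons insubF// is_wm_cons// leqNgt wi. Qed.

Lemma wm_cons_wm_behead i w : (0 < i)%N -> wm_head w = i ->
  wm_cons i (wm_behead w) = Some w.
Proof. by move=> i0 wi; apply: wm_cons_behead; rewrite /starts /= wm_head_starts// wi. Qed.

(** The word i :: w is admissible if and only if the head of w is at most i. *)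
Lemma source_genE i x w : (0 < i)%N ->
  cmul (cstar (fgen i)) (fgen i) x w = if (wm_head w <= i)%N then x w else 0.
Proof.
move=> i0; rewrite wa_mulE fgen_starE//; case: leqP => wi; last by rewrite wm_cons_nil.
have [v vE] := wm_cons_some i0 wi; rewrite vE fgenE//.
by have [-> ->] := wm_head_cons vE; rewrite eqxx.
Qed.

Lemma range_genE i x w : (0 < i)%N ->
  cmul (fgen i) (cstar (fgen i)) x w = if wm_head w == i then x w else 0.
Proof.
move=> i0; rewrite wa_mulE fgenE//; case: eqP => // wi.
by rewrite fgen_starE// wm_cons_wm_behead.
Qed.

Lemma fgen0E x w : fgen 0 x w = if wm_head w == 0%N then x w else 0.
Proof.
rewrite /fgen opalgBE -[LHS]/(cmul (cstar (fgen 1)) (fgen 1) x w - cmul (fgen 1) (cstar (fgen 1)) x w).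
rewrite source_genE// range_genE//.
by case: (wm_head w) => [|[|n]] /=; rewrite ?subr0 ?subrr.
Qed.

Lemma fgen0_star : cstar (fgen 0) = fgen 0.
Proof. by rewrite /fgen cstarB !cstarM !cstarK. Qed.

Lemma rproj_fgenE k x w : rproj fgen k x w = if wm_head w == k then x w else 0.
Proof.
have [->|k0] := posnP k; last exact: range_genE.
by rewrite /rproj fgen0_star wa_mulE !fgen0E; case: eqP.
Qed.

Lemma wa_sumE n (F : nat -> WA) x w :
  (\sum_(k < n) F k) x w = \sum_(k < n) F k x w.
Proof.
elim: n => [|n ih]; first by rewrite !big_ord0.
by rewrite !big_ord_recr opalgDE l2DE; congr (_ + _); exact: ih.
Qed.

Lemma fgen_relations : wm_relations fgen.
Proof.
split.
- move=> i; apply: wa_eq => x w; rewrite wa_mulE -/(rproj fgen i) rproj_fgenE.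
  case: eqP => // /eqP wi; have [i0|i0] := posnP i.
    by rewrite i0 fgen0E -i0 (negbTE wi).
  by rewrite fgenE// (negbTE wi).
- move=> i j ij; apply: wa_eq => x w; rewrite wa_mulE.
  have [i0|i0] := posnP i.
    subst i; rewrite fgen0_star fgen0E; case: eqP => // w0.
    have j0 : (0 < j)%N by rewrite lt0n eq_sym.
    by rewrite fgenE// w0 (negbTE ij).
  rewrite fgen_starE//; case wi: (wm_cons i w) => [v|//].
  have [vi _] := wm_head_cons wi.
  have [j0|j0] := posnP j; last by rewrite fgenE// vi (negbTE ij).
  by rewrite j0 fgen0E vi -j0 (negbTE ij).
- move=> i; apply: wa_eq => x w; rewrite (wa_sumE _ (rproj fgen)).
  have -> : cmul (cstar (fgen i)) (fgen i) x w = if (wm_head w <= i)%N then x w else 0.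
    have [->|i0] := posnP i; last exact: source_genE.
    by rewrite leqn0 fgen0_star wa_mulE !fgen0E; case: eqP.
  under eq_bigr do rewrite rproj_fgenE.
  rewrite -big_mkcond /=; case: leqP => wi.
    by rewrite (big_pred1 (Ordinal (wi : wm_head w < i.+1)%N))// => k; rewrite eq_sym.
  rewrite big1// => k /eqP wk; have := ltn_ord k.
  by rewrite -wk ltnS leqNgt wi.
- by apply: wa_eq => x w; rewrite fgen0_star wa_mulE !fgen0E; case: eqP.
Qed.

Lemma prefix_wm i U w : prefix (i :: U) (val w) =
  (ohead (val w) == Some i) && prefix U (val (wm_behead w)).
Proof. by case: w => [[|j w] pw] //=; rewrite -[Some j == _]/(j == i) eq_sym. Qed.

(** Creating the letters of U moves coordinates from the tail to U ++ tail. *)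
Lemma act_fgenE U a x w : all (leq 1) U ->
  act fgen U a x w =
    if prefix U (val w) then a x (iter (size U) wm_behead w) else 0.
Proof.
elim: U w => [|i U ih] w; first by rewrite prefix0s.
move=> /andP[i0 U0]; rewrite -[act fgen (i :: U) a]/(cmul (fgen i) (act fgen U a)).
rewrite wa_mulE fgenE// ih// -wm_head_starts// prefix_wm [size (i :: U)]/= iterSr.
by case: (_ == _).
Qed.

Lemma star_fgen_delta i v : (0 < i)%N ->
  cstar (fgen i) (l2delta R v) = if wm_head v == i then l2delta R (wm_behead v) else 0.
Proof.
move=> i0; apply: l2P => w; rewrite fgen_starE//.
case wi: (wm_cons i w) => [u|].
  have [ui uw] := wm_head_cons wi; have [vi|vi] := eqVneq (wm_head v) i; rewrite /=.
    have -> : (u == v) = (w == wm_behead v) => //.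
    apply/eqP/eqP => [<-//|wv].
    by apply: Some_inj; rewrite -wi wv wm_cons_wm_behead.
  by have /negbTE -> : u != v by apply: contraNneq vi => <-; rewrite ui.
have [vi|//] := eqVneq (wm_head v) i; rewrite /=; case: eqP => // wv.
by rewrite wv wm_cons_wm_behead in wi.
Qed.

Lemma rproj_fgen_delta k v :
  rproj fgen k (l2delta R v) = if wm_head v == k then l2delta R v else 0.
Proof.
apply: l2P => w; rewrite rproj_fgenE /=.
case: (eqVneq w v) => [->|wv]; first by case: eqP => //= _; rewrite eqxx.
by case: ifP => _; case: ifP => //= _; rewrite (negbTE wv).
Qed.

Lemma star_act_delta U k v : all (leq 1) U ->
  cstar (act fgen U (rproj fgen k)) (l2delta R v) =
    if prefix U (val v) && (wm_head (iter (size U) wm_behead v) == k)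
    then l2delta R (iter (size U) wm_behead v) else 0.
Proof.
elim: U v => [|i U ih] v; first by rewrite [act _ _ _]/= rproj_star rproj_fgen_delta prefix0s.
move=> /andP[i0 U0].
rewrite -[act fgen (i :: U) _]/(cmul (fgen i) (act fgen U (rproj fgen k))).
rewrite cstarM wa_mulE star_fgen_delta// -wm_head_starts// prefix_wm [size (i :: U)]/= iterSr.
case: (_ == _); rewrite ?andTb ?andFb; first exact: ih.
exact: bounded_lin0 (opalg_bounded _).
Qed.

Definition code_word (k : nat) (U : seq nat) : wm_word :=
  insubd nilword (if k == 0%N then U else rcons U k).

(** The matrix entry of a at the basis vectors attached to U k and V k. *)
Definition entry (f : code) (a : WA) : R[i] :=
  let: (U, k, V) := f in a (l2delta R (code_word k V)) (code_word k U).

(** The operator s_U p_k s_V^* sends e_(V r) to e_(U r) when r has head k. *)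
Lemma mon_fgen_delta U k V u v : all (leq 1) U -> all (leq 1) V ->
  mon fgen (U, k, V) (l2delta R v) u =
    [&& prefix U (val u), wm_head (iter (size U) wm_behead u) == k,
        prefix V (val v), wm_head (iter (size V) wm_behead v) == k &
        iter (size U) wm_behead u == iter (size V) wm_behead v]%:R.
Proof.
move=> U0 V0; rewrite /mon wa_mulE star_act_delta//.
have [/andP[pV kV]|nV] := boolP (prefix V (val v) && _); last first.
  rewrite (bounded_lin0 (opalg_bounded _)).
  by move: nV; rewrite negb_and => /orP[] /negbTE ->; rewrite /= ?andbF.
rewrite act_fgenE// pV kV /=; case: (prefix U (val u)) => //=.
by rewrite rproj_fgenE; case: eqP.
Qed.

Lemma val_iter_behead n w : val (iter n wm_behead w) = drop n (val w).
Proof. by elim: n => [|n ih]; rewrite ?drop0//= ih -drop1 drop_drop add1n. Qed.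

Lemma code_wordE n k U : ok_word n k U ->
  val (code_word k U) = if k == 0%N then U else rcons U k.
Proof.
move=> /and3P[kn Un sU]; rewrite /code_word val_insubd; case: ifP => // /negP[].
have U0 : all (leq 1) U by apply: sub_all Un => i /andP[].
have sUU : sorted geq U by case: (U) sU => [//|u U'] /=; rewrite rcons_path => /andP[].
rewrite /is_wm_word; case: eqP => [_|/eqP k0]; first by rewrite U0.
by rewrite all_rcons lt0n k0 U0.
Qed.

(** Suppose that both words of the code (U, k, V) decompose as U' r and V' r with
    r of head k'. Comparing lengths, r has length 0 if k' = 0 and length 1
    otherwise: in the second case U' already has the maximal length d, and the
    words of a canonical code have at most d letters, or d + 1 if k > 0. *)
Lemma canonical_prefix n d U k V U' k' V' :
  canonical n d (U, k, V) -> canonical n d (U', k', V') ->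
  let u := if k == 0%N then U else rcons U k in
  let v := if k == 0%N then V else rcons V k in
  [&& prefix U' u, head 0%N (drop (size U') u) == k',
      prefix V' v, head 0%N (drop (size V') v) == k' &
      drop (size U') u == drop (size V') v] = ((U', k', V') == (U, k, V)).
Proof.
move=> /and5P[oU oV Ud _ kU] /and5P[oU' oV' Ud' _ kU'] u v.
have pos m l W : ok_word m l W -> all (leq 1) W.
  by move=> /and3P[_ + _]; apply: sub_all => i /andP[].
apply/idP/idP; last first.
  move=> /eqP[-> -> ->]; rewrite /u /v; case: (eqVneq k 0%N) => [->|k0].
    by rewrite !prefix_refl !drop_size /=.
  by rewrite -!cats1 !prefix_prefix !drop_size_cat//= !eqxx.
move=> /and5P[/prefixP[r ur] hr /prefixP[r' vr] _ rr].
rewrite ur drop_size_cat// in hr rr; rewrite vr drop_size_cat// in rr.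
have u_pos : all (leq 1) u.
  rewrite /u; case: eqP => [_|/eqP k0]; first exact: pos oU.
  by rewrite all_rcons lt0n k0 (pos _ _ _ oU).
have r0 : k' = 0%N -> r = [::].
  move=> k'0; case: r ur hr {rr} => [//|a r] ur /eqP; rewrite k'0 /= => a0.
  by move: u_pos; rewrite ur a0 all_cat /= andbF.
have {}rr : r = r' := eqP rr; subst r'.
have szu : size u = (size U + (k != 0%N))%N.
  by rewrite /u; case: eqP => _ /=; rewrite ?addn0// size_rcons addn1.
have szu' : size u = (size U' + size r)%N by rewrite ur size_cat.
move: kU'; have [k'0 _|k'0 /= /eqP U'd] := eqVneq k' 0%N.
  have {r0} re := r0 k'0; subst r; rewrite !cats0 in ur vr.
  move: kU; have [k0 _|k0 /= /eqP Udd] := eqVneq k 0%N.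
    by rewrite /u /v k0 /= in ur vr; rewrite ur vr k'0 k0.
  exfalso; move: szu szu'; rewrite k0 Udd addn1 addn0 => ->.
  by move=> dU'; move: Ud'; rewrite -dU' ltnn.
have r_gt0 : (0 < size r)%N by case: r hr {ur vr szu' r0} => //=; rewrite eq_sym (negbTE k'0).
move: kU; have [k0 _|k0 /= /eqP Udd] := eqVneq k 0%N.
  exfalso; move: szu szu'; rewrite k0 /= addn0 U'd => -> Ue.
  by move: Ud; rewrite Ue -{2}[d]addn0 leq_add2l leqNgt r_gt0.
have r1 : size r = 1%N.
  by move: szu'; rewrite szu Udd U'd k0 => /addnI <-.
case: r r1 ur vr hr {r0 r_gt0 szu'} => [//|a []]// _; rewrite /u /v (negbTE k0) !cats1.
move=> /rcons_inj[-> ->] /rcons_inj[->] /= /eqP <-.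
by [].
Qed.

Lemma entry_fgen n d f f' : canonical n d f -> canonical n d f' ->
  entry f (mon fgen f') = (f' == f)%:R.
Proof.
case: f => [[U k] V]; case: f' => [[U' k'] V'] cf cf'.
have pos m l W : ok_word m l W -> all (leq 1) W.
  by move=> /and3P[_ + _]; apply: sub_all => i /andP[].
have /and5P[oU oV _ _ _] := cf; have /and5P[oU' oV' _ _ _] := cf'.
rewrite /entry mon_fgen_delta ?(pos _ _ _ oU') ?(pos _ _ _ oV')//.
rewrite -(canonical_prefix cf cf') /wm_head -val_eqE !val_iter_behead.
by rewrite (code_wordE oU) (code_wordE oV).
Qed.

Lemma l2norm_delta v : l2norm (l2delta R v) <= 1.
Proof.
rewrite -(@ler_pXn2r _ 2)// ?nnegrE ?l2norm_ge0 ?ler01// expr1n sqr_l2norm.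
rewrite -lee_fin -psumE; last 2 first.
- by move=> i; exact: sqr_ge0.
- exact: sq_abs_summable.
rewrite (esumID [set v]); last by move=> *; rewrite lee_fin sqr_ge0.
rewrite setTI esum_set1 ?lee_fin ?sqr_ge0//= eqxx normc1 expr1n.
rewrite [X in (_ + X)%E]esum1 ?adde0// => j [_ /= /eqP/negbTE ->].
by rewrite [normc _]normc0 expr0n.
Qed.

Lemma entry_le f a : normc (entry f a) <= nm a.
Proof.
case: f => [[U k] V]; apply: le_trans (coord_le_l2norm _ _) _.
apply: le_trans (opnormP _ (opalg_bounded a)) _.
rewrite -[leRHS]mulr1; apply: ler_wpM2l; last exact: l2norm_delta.
exact: opnorm_ge0 (opalg_bounded a).
Qed.

Lemma entry_lin f (c : R[i]) a b : entry f (c *: a + b) = c * entry f a + entry f b.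
Proof. by case: f => [[U k] V]. Qed.

End fock_generators.

(** * Universality *)

Lemma nm_dist_tri (R : realType) (A : cstarAlgType R) (a b c : A) (e1 e2 : R) :
  nm (a - b) <= e1 -> nm (b - c) <= e2 -> nm (a - c) <= e1 + e2.
Proof.
by move=> ab bc; rewrite -(subrKA b); apply: le_trans (nmD _ _) _; exact: lerD.
Qed.

Lemma nm_lin_dist (R : realType) (A : cstarAlgType R) (c : R[i]) (a a' b b' : A) (e : R) :
  nm (a - a') <= e -> nm (b - b') <= e ->
  nm ((c *: a + b) - (c *: a' + b')) <= (normc c + 1) * e.
Proof.
move=> aa' bb'; rewrite opprD addrACA -scalerBr; apply: le_trans (nmD _ _) _.
by rewrite nmZ mulrDl mul1r; apply: lerD => //; apply: ler_wpM2l => //; exact: normc_ge0.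
Qed.

Lemma nm_mul_dist (R : realType) (A : cstarAlgType R) (a a' b b' : A) (e : R) :
  e <= 1 -> nm (a - a') <= e -> nm (b - b') <= e ->
  nm (cmul a b - cmul a' b') <= (nm a + nm b + 1) * e.
Proof.
move=> e1 aa' bb'.
have -> : cmul a b - cmul a' b' = cmul (a - a') b + cmul (a' - a) (b - b') + cmul a (b - b').
  rewrite -addrA -cmulDl subrK cmulBl cmulBr addrA subrK //.
apply: le_trans (nmD _ _) _.
have := nmD (cmul (a - a') b) (cmul (a' - a) (b - b')).
have := nmM (a - a') b; have := nmM (a' - a) (b - b'); have := nmM a (b - b').
rewrite (nmBC a' a); have := nm_ge0 a; have := nm_ge0 b.
have := nm_ge0 (a - a'); have := nm_ge0 (b - b'); nra.
Qed.

Section fock_universal.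
Variable R : realType.
Local Notation H := (wm_fock R).
Local Notation WA := (opalg (wm_opset R)).

(** The values of a C*-subalgebra of the type opalg form a C*-subalgebra of
    operators, to which the minimality of wm_cstar applies. *)
Lemma fgen_generated : cstar_generated (range (@fgen R)) = setT.
Proof.
apply/seteqP; split=> // a _ S SS genS.
have [[S0 SD] SM Sst Sc] := SS.
have [Wb [W0 WD] WM Wadj Wc] := opset_subalg (wm_opset R).
pose S' := [set T : H -> H | exists2 b : WA, opval b = T & S b].
suff [b /val_inj <-//] : S' a.
apply: (opalgP a); [split|].
- by move=> T [b <- _]; exact: opalg_bounded.
- split; first by exists 0.
  move=> c T T' [b <- Sb] [b' <- Sb']; exists (c *: b + b') => //; exact: SD.
- by move=> T T' [b <- Sb] [b' <- Sb']; exists (cmul b b') => //; exact: SM.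
- move=> T T' [b <- Sb] _ bT'; exists (cstar b); last exact: Sst.
  exact: adjoint_uniq (opalg_cstar_adj b) bT'.
- move=> T bT hT; have WT : opset_set (wm_opset R) T.
    apply: Wc => // e e0; have [T' [b <- _] hb] := hT e e0.
    by exists b => //; exact: opalgP.
  exists (mkop WT) => //; apply: (nm_closedP S).1 => // e e0.
  have [T' [b bT' Sb] hb] := hT e e0; exists b => //.
  apply: opnorm_le => [|x]; first exact: ltW.
  by rewrite opalgBE bT'; exact: hb.
move=> T [[//|i] _ [->|[_ aT]]].
  by exists (fgen R i.+1) => //; apply: genS; exists i.+1.
exists (cstar (fgen R i.+1)); last by apply/Sst/genS; exists i.+1.
exact: adjoint_uniq (opalg_cstar_adj (fgen R i.+1)) aT.
Qed.

Section hom.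
Variables (B : cstarAlgType R) (t : nat -> B).
Hypothesis rel_t : wm_relations t.

(** The closure of the set of pairs (F(s), F(t)), F ranging over *-polynomials. *)
Definition wm_graph (a : WA) (b : B) : Prop :=
  forall e : R, 0 < e -> exists (n d : nat) (F : forall A : cstarAlgType R, (nat -> A) -> A),
    [/\ rep n d F, nm (a - F WA (@fgen R)) <= e & nm (b - F B t) <= e].

Lemma wm_graph_le a b : wm_graph a b -> nm b <= nm a.
Proof.
move=> ab; apply/ler_addgt0Pr => e e0.
have e2 : 0 < e / 2 by rewrite divr_gt0.
have [n [d [F [rF Fa Fb]]]] := ab _ e2.
have := nm_domination (@fgen_relations R) (@entry_lin R) (@entry_le R) (@entry_fgen R) rF rel_t.
move=> FBA.
have b_le := nmD (b - F B t) (F B t); rewrite subrK in b_le.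
have a_le := nmB a (a - F WA (@fgen R)); rewrite subKr in a_le.
apply: (le_trans b_le); apply: (@le_trans _ _ (e / 2 + (nm a + e / 2))).
  by apply: lerD => //; apply: (le_trans FBA); apply: (le_trans a_le); rewrite lerD2l.
by rewrite addrCA -splitr.
Qed.

Lemma wm_graph_lin (c : R[i]) a b a' b' : wm_graph a b -> wm_graph a' b' ->
  wm_graph (c *: a + a') (c *: b + b').
Proof.
move=> ab ab' e e0.
have c0 := normc_ge0 c; have C0 : 0 < normc c + 1 by rewrite ltr_wpDl.
have e1 : 0 < e / (normc c + 1) by rewrite divr_gt0.
have [n [d [F [rF Fa Fb]]]] := ab _ e1; have [n' [d' [G [rG Ga Gb]]]] := ab' _ e1.
exists (maxn n n'), (maxn d d'), (fun A s => c *: F A s + G A s); split.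
- by apply: spanned_lin; [apply: repS rF|apply: repS rG]; rewrite ?leq_maxl ?leq_maxr.
- by apply: le_trans (nm_lin_dist c Fa Ga) _; rewrite mulrC divfK ?gt_eqF.
- by apply: le_trans (nm_lin_dist c Fb Gb) _; rewrite mulrC divfK ?gt_eqF.
Qed.

Lemma wm_graph_star a b : wm_graph a b -> wm_graph (cstar a) (cstar b).
Proof.
move=> ab e e0; have [n [d [F [rF Fa Fb]]]] := ab _ e0.
exists n, d, (fun A s => cstar (F A s)); split; first exact: rep_star.
  by rewrite -cstarB nm_star.
by rewrite -cstarB nm_star.
Qed.

Lemma wm_graph_mul a b a' b' : wm_graph a b -> wm_graph a' b' ->
  wm_graph (cmul a a') (cmul b b').
Proof.
move=> ab ab' e e0; set C := Num.max (nm a + nm a') (nm b + nm b') + 1.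
have C0 : 0 < C by rewrite ltr_wpDl// le_max addr_ge0 ?nm_ge0.
have e1 : 0 < Num.min 1 (e / C) by rewrite lt_min ltr01 divr_gt0.
have [n [d [F [rF Fa Fb]]]] := ab _ e1; have [n' [d' [G [rG Ga Gb]]]] := ab' _ e1.
have small : Num.min 1 (e / C) <= 1 by rewrite ge_min lexx.
have le_e (D : R) : D + 1 <= C -> (D + 1) * Num.min 1 (e / C) <= e.
  move=> DC; apply: (@le_trans _ _ (C * Num.min 1 (e / C))).
    by rewrite ler_wpM2r// ltW.
  by rewrite mulrC -ler_pdivlMr// ge_min lexx orbT.
exists (maxn n n'), (2 * d + d' + 4)%N, (fun A s => cmul (F A s) (G A s)); split.
- apply: rep_mul; [apply: repS (leqnn _) rF|apply: repS (leqnn _) rG].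
    exact: leq_maxl.
  exact: leq_maxr.
- apply: le_trans (nm_mul_dist small Fa Ga) _; apply: le_e.
  by rewrite lerD2r le_max lexx.
- apply: le_trans (nm_mul_dist small Fb Gb) _; apply: le_e.
  by rewrite lerD2r le_max lexx orbT.
Qed.

(** A letter is a combination of monomials: t_i = t_i (sum_(k <= i) p_k). *)
Lemma wm_graph_gen i : wm_graph (fgen R i) (t i).
Proof.
have : rep i 1 (fun (A : cstarAlgType R) s => s i).
  have rp (k : 'I_i.+1) : rep i 0 (fun (A : cstarAlgType R) s => mon s ([::], k : nat, [::])).
    by apply: spanned_mon; rewrite /= /ok_word /= -ltnS ltn_ord.
  apply: eq_spanned (rep_gen (leqnn i) (spanned_sum _ rp)) => A s rs.
  rewrite [RHS](gen_source rs); congr (cmul _ _); apply: eq_bigr => k _.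
  by rewrite /mon /= rproj_star rproj_idem.
move=> r e e0; exists i, 1, (fun A s => s i); split=> //.
  by rewrite subrr nm0 ltW.
by rewrite subrr nm0 ltW.
Qed.

Lemma wm_graph_uniq a b b' : wm_graph a b -> wm_graph a b' -> b = b'.
Proof.
move=> ab ab'; have := wm_graph_lin (-1) ab ab'; rewrite !scaleN1r addNr => /wm_graph_le.
rewrite nm0 => le0; apply/eqP; rewrite -subr_eq0 -oppr_eq0 opprB addrC; apply/eqP.
by apply: nm_eq0; apply/eqP; rewrite eq_le nm_ge0 le0.
Qed.

Lemma wm_graph_le_sub a b a' b' : wm_graph a b -> wm_graph a' b' ->
  nm (b - b') <= nm (a - a').
Proof.
move=> ab ab'; have := wm_graph_lin (-1) ab' ab; rewrite !scaleN1r => /wm_graph_le.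
by rewrite addrC [X in _ <= nm X]addrC.
Qed.

(** The domain of the graph is closed because passing from a to b does not
    increase distances and B is complete. *)
Lemma wm_graph_total a : exists b, wm_graph a b.
Proof.
have : cstar_generated (range (@fgen R)) a by rewrite fgen_generated.
move=> /(_ [set a | exists b, wm_graph a b]); apply; last first.
  by move=> _ [i _ <-]; exists (t i); exact: wm_graph_gen.
split.
- split; first by exists (t 0 - t 0); have := wm_graph_lin (-1) (wm_graph_gen 0) (wm_graph_gen 0); rewrite !scaleN1r !addNr subrr.
  by move=> c x y [x' hx] [y' hy]; exists (c *: x' + y'); exact: wm_graph_lin.
- by move=> x y [x' hx] [y' hy]; exists (cmul x' y'); exact: wm_graph_mul.
- by move=> x [x' hx]; exists (cstar x'); exact: wm_graph_star.
apply/nm_closedP => x hx.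
have /choice[u hu] n : exists y, (exists b, wm_graph y b) /\ nm (x - y) <= invS R n.
  by have [y yb xy] := hx _ (invS_gt0 R n); exists y.
have /choice[v hv] n : exists b, wm_graph (u n) b by case: (hu n).
have [n m|b hb] := @nm_complete R B v.
  apply: le_trans (wm_graph_le_sub (hv n) (hv m)) _.
  rewrite -(subrKA x); apply: le_trans (nmD _ _) _.
  by rewrite (nmBC (u n)); apply: lerD; [exact: (hu n).2|exact: (hu m).2].
exists b => e e0; have e2 : 0 < e / 2 by rewrite divr_gt0.
have [n ne] := invS_lt e2; have [k [d [F [rF Fa Fb]]]] := hv n _ e2.
exists k, d, F; split=> //.
  apply: le_trans (nm_dist_tri (hu n).2 Fa) _.
  by rewrite [leRHS]splitr lerD2r ltW.
have bv : nm (b - v n) <= invS R n by rewrite nmBC.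
apply: le_trans (nm_dist_tri bv Fb) _.
by rewrite [leRHS]splitr lerD2r ltW.
Qed.

Lemma fgen_hom : exists f : WA -> B, star_hom f /\ (forall i, f (fgen R i) = t i).
Proof.
have [f hf] := choice wm_graph_total.
exists f; split; last by move=> i; apply: wm_graph_uniq (hf _) (wm_graph_gen i).
split.
- by move=> c a b; apply: wm_graph_uniq (hf _) (wm_graph_lin c (hf a) (hf b)).
- by move=> a b; apply: wm_graph_uniq (hf _) (wm_graph_mul (hf a) (hf b)).
- by move=> a; apply: wm_graph_uniq (hf _) (wm_graph_star (hf a)).
Qed.

End hom.

Lemma fgen_universal : wm_universal (@fgen R).
Proof.
by split; [exact: fgen_relations|exact: fgen_generated|move=> B t; exact: fgen_hom].
Qed.

End fock_universal.

(** Contractivity of f makes the set of its fixed points closed, hence a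
    C*-subalgebra. *)
Lemma star_hom_id (R : realType) (A : cstarAlgType R) (X : set A) (f : A -> A) :
  star_hom f -> cstar_generated X = setT -> (forall x, X x -> f x = x) ->
  forall a, f a = a.
Proof.
move=> hf gX fX a; have [fl fM fs] := hf; have f_le := star_hom_nm hf.
have : cstar_generated X a by rewrite gX.
move=> /(_ [set a | f a = a]); apply => //.
have f0 : f 0 = 0 by have := fl (-1) 0 0; rewrite !scaleN1r oppr0 addr0 addNr.
split.
- by split=> // c x y /= fx fy; rewrite fl fx fy.
- by move=> x y /= fx fy; rewrite fM fx fy.
- by move=> x /= fx; rewrite fs fx.
apply/nm_closedP => x hx /=; apply: (@nm_eq_lim _ _ 2) => n.
have [y fy xy] := hx _ (invS_gt0 R n).
have fxy : f (x - y) = f x - f y.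
  by have := fl (-1) y x; rewrite !scaleN1r ![- _ + _]addrC.
have -> : f x - x = f (x - y) + (y - x) by rewrite fxy fy subrKA.
have := nmD (f (x - y)) (y - x); rewrite (nmBC y); have := f_le (x - y); lra.
Qed.

Lemma star_hom_comp (R : realType) (A B C : cstarAlgType R) (f : A -> B) (g : B -> C) :
  star_hom f -> star_hom g -> star_hom (g \o f).
Proof.
move=> [fl fM fs] [gl gM gs]; split.
- by move=> c a b; rewrite /= fl gl.
- by move=> a b; rewrite /= fM gM.
- by move=> a; rewrite /= fs gs.
Qed.

Theorem corollary3p7 (R : realType) :
  (exists (U : cstarAlgType R) (s : nat -> U), wm_universal s) /\
  (forall (U : cstarAlgType R) (s : nat -> U),
     wm_universal s -> isomorphic_to_ops U (wm_cstar R)).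
Proof.
have fgenU := fgen_universal R; split; first by exists (opalg (wm_opset R)), (@fgen R).
move=> U s [rel_s gen_s univ_s].
have [rel_f gen_f univ_f] := fgenU.
have [f [hf fs]] := univ_s _ _ rel_f; have [g [hg gs]] := univ_f _ _ rel_s.
have gf : forall a, g (f a) = a.
  apply: (star_hom_id (star_hom_comp hf hg) gen_s) => _ [i _ <-] /=.
  by rewrite fs gs.
have fg : forall a, f (g a) = a.
  apply: (star_hom_id (star_hom_comp hg hf) gen_f) => _ [i _ <-] /=.
  by rewrite gs fs.
have [fl fM fst] := hf.
exists (fun a => opval (f a)); split.
- by move=> c a b x; rewrite fl.
- by move=> a b; rewrite fM.
- by move=> a; rewrite fst; exact: opalg_cstar_adj.
- by move=> a b /val_inj fab; rewrite -(gf a) fab gf.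
apply/seteqP; split=> [_ [a _ <-]|T WT]; first exact: (opalgP (f a)).
by exists (g (@mkop _ _ (wm_opset R) T WT)) => //; rewrite fg.
Qed.
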